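(* Let $D$ be an integral domain and $\star$ a semistar operation on $D$. The following are equivalent: (1) $D$ is a $\star$-Dedekind domain ($\star$-DD). (2) For each nonzero ideal $I$ of $D$, there exist a finite family of quasi-$\star_f$-prime ideals $P_1,P_2,\ldots,P_n$ of $D$, pairwise $\star_f$-comaximal, and a finite family of non-negative integers $e_1,e_2,\ldots,e_n$ such that $I^{\tilde\star}=(P_1^{e_1}P_2^{e_2}\cdots P_n^{e_n})^{\tilde\star}$. Moreover, if (2) holds and if $I$ is a nonzero ideal of $D$ with $I^{\tilde\star}\neq D^{\tilde\star}$, then the factorization in (2) can be chosen so that $P_i^{\tilde\star}\neq D^{\tilde\star}$ for each $i=1,\ldots,n$ and all the integers $e_1,\ldots,e_n$ are positive, and such a factorization is unique (up to the order of the factors).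
   Context: Let $D$ be an integral domain with quotient field $K$. $\overline{\boldsymbol F}(D)$ denotes the set of all nonzero $D$-submodules of $K$, and $\boldsymbol f(D)$ the set of nonzero finitely generated $D$-submodules of $K$. A semistar operation on $D$ is a map $\star:\overline{\boldsymbol F}(D)\to\overline{\boldsymbol F}(D)$, $E\mapsto E^\star$, such that for all $0\neq x\in K$ and $E,F\in\overline{\boldsymbol F}(D)$: $(xE)^\star=xE^\star$; $E\subseteq F$ implies $E^\star\subseteq F^\star$; $E\subseteq E^\star$ and $(E^\star)^\star=E^\star$. The semistar operation $\star_f$ is defined by $E^{\star_f}:=\bigcup\{F^\star : F\in\boldsymbol f(D),\ F\subseteq E\}$. A quasi-$\star$-ideal of $D$ is a nonzero ideal $I$ of $D$ with $I=I^\star\cap D$; a quasi-$\star$-prime is a nonzero prime ideal that is a quasi-$\star$-ideal (and similarly for $\star_f$). $\mathcal{M}(\star_f)$ is the set of quasi-$\star_f$-maximal ideals, i.e. the maximal elements of the set of proper quasi-$\star_f$-ideals (these are prime). The semistar operation $\tilde\star$ is defined by $E^{\tilde\star}:=\bigcap\{ED_Q : Q\in\mathcal{M}(\star_f)\}$ (the empty intersection being $K$). $D$ is $\star$-Noetherian if it has the ascending chain condition on quasi-$\star$-ideals. A nonzero ideal $I$ is $\star$-invertible if $(II^{-1})^\star=D^\star$, where $I^{-1}=\{z\in K: zI\subseteq D\}$. $D$ is a P$\star$MD if each nonzero finitely generated ideal of $D$ is $\star_f$-invertible. $D$ is a $\star$-Dedekind domain ($\star$-DD) if it is $\star$-Noetherian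 and a P$\star$MD. Nonzero ideals $A,B$ of $D$ are $\star$-comaximal if $(A+B)^\star=D^\star$ (and similarly for $\star_f$); ''pairwise'' refers to distinct indices. In (2) the finite family may be empty, the empty product being $D$. *)

(* Defs.v *)
From HB Require Import structures.
From mathcomp Require Import all_boot all_order all_algebra.
From mathcomp Require Import boolp classical_sets.

Set Implicit Arguments.
Unset Strict Implicit.
Unset Printing Implicit Defensive.
Import GRing.Theory.
Local Open Scope ring_scope.
Local Open Scope classical_set_scope.

(* D is embedded in its quotient field K = {fraction D} by tofrac; ideals of D *)
(* and D-submodules of K are all represented as subsets of K.                  *)
Definition Dset (D : idomainType) : set {fraction D} := range (@tofrac D).
Arguments Dset D : clear implicits.

Definition submodule (D : idomainType) (E : set {fraction D}) : Prop :=
  [/\ E 0, forall x y, E x -> E y -> E (x + y)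
    & forall a x, Dset D a -> E x -> E (a * x)].

Definition nonzero (D : idomainType) (E : set {fraction D}) : Prop :=
  exists2 x, E x & x != 0.

Definition Fbar (D : idomainType) : set (set {fraction D}) :=
  [set E | submodule E /\ nonzero E].
Arguments Fbar D : clear implicits.

Definition dspan (D : idomainType) (n : nat) (g : 'I_n -> {fraction D}) :
    set {fraction D} :=
  [set x | exists2 a : 'I_n -> {fraction D},
     forall i, Dset D (a i) & x = \sum_i a i * g i].

Definition fin_gen (D : idomainType) (E : set {fraction D}) : Prop :=
  exists (n : nat) (g : 'I_n -> {fraction D}), E = dspan g.

Definition fgFbar (D : idomainType) : set (set {fraction D}) :=
  [set E | Fbar D E /\ fin_gen E].
Arguments fgFbar D : clear implicits.

Definition dilate (D : idomainType) (x : {fraction D}) (E : set {fraction D}) :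
    set {fraction D} :=
  [set x * y | y in E].

Definition addm (D : idomainType) (E F : set {fraction D}) : set {fraction D} :=
  [set x + y | x in E & y in F].

Definition mulm (D : idomainType) (E F : set {fraction D}) : set {fraction D} :=
  [set z | exists n (x y : 'I_n -> {fraction D}),
     [/\ forall i, E (x i), forall i, F (y i) & z = \sum_i x i * y i]].

Definition expm (D : idomainType) (E : set {fraction D}) (e : nat) :
    set {fraction D} :=
  iter e (mulm E) (Dset D).

(* A semistar operation is a map on Fbar D; here it is extended to all subsets *)
(* of K, its values outside Fbar D being arbitrary and never used.             *)
Definition semistar (D : idomainType)
    (star : set {fraction D} -> set {fraction D}) : Prop :=
  [/\ forall E, Fbar D E -> Fbar D (star E),
      forall x E, x != 0 -> Fbar D E -> star (dilate x E) = dilate x (star E),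
      forall E F, Fbar D E -> Fbar D F -> E `<=` F -> star E `<=` star F,
      forall E, Fbar D E -> E `<=` star E
    & forall E, Fbar D E -> star (star E) = star E].

Definition star_f (D : idomainType)
    (star : set {fraction D} -> set {fraction D}) (E : set {fraction D}) :
    set {fraction D} :=
  \bigcup_(F in [set F | fgFbar D F /\ F `<=` E]) star F.

Definition nz_ideal (D : idomainType) (I : set {fraction D}) : Prop :=
  Fbar D I /\ I `<=` Dset D.

Definition prime_ideal (D : idomainType) (P : set {fraction D}) : Prop :=
  [/\ submodule P, P `<=` Dset D, P <> Dset D
    & forall a b, Dset D a -> Dset D b -> P (a * b) -> P a \/ P b].

Definition quasi_ideal (D : idomainType)
    (star : set {fraction D} -> set {fraction D}) (I : set {fraction D}) : Prop :=
  nz_ideal I /\ I = star I `&` Dset D.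

Definition quasi_prime (D : idomainType)
    (star : set {fraction D} -> set {fraction D}) (P : set {fraction D}) : Prop :=
  prime_ideal P /\ quasi_ideal star P.

Definition quasi_maximal (D : idomainType)
    (star : set {fraction D} -> set {fraction D}) (Q : set {fraction D}) : Prop :=
  [/\ quasi_ideal star Q, Q <> Dset D
    & forall J, quasi_ideal star J -> J <> Dset D -> Q `<=` J -> J = Q].

Definition localization (D : idomainType) (Q : set {fraction D}) :
    set {fraction D} :=
  [set a / s | a in Dset D & s in Dset D `\` Q].

Definition star_tilde (D : idomainType)
    (star : set {fraction D} -> set {fraction D}) (E : set {fraction D}) :
    set {fraction D} :=
  \bigcap_(Q in [set Q | quasi_maximal (star_f star) Q])
     mulm E (localization Q).

Definition star_noetherian (D : idomainType)
    (star : set {fraction D} -> set {fraction D}) : Prop :=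
  forall I : nat -> set {fraction D},
    (forall n, quasi_ideal star (I n)) -> (forall n, I n `<=` I n.+1) ->
    exists N, forall n, (N <= n)%N -> I n = I N.

Definition inv_ideal (D : idomainType) (I : set {fraction D}) :
    set {fraction D} :=
  [set z | dilate z I `<=` Dset D].

Definition star_invertible (D : idomainType)
    (star : set {fraction D} -> set {fraction D}) (I : set {fraction D}) : Prop :=
  star (mulm I (inv_ideal I)) = star (Dset D).

Definition PstarMD (D : idomainType)
    (star : set {fraction D} -> set {fraction D}) : Prop :=
  forall I, nz_ideal I -> fin_gen I -> star_invertible (star_f star) I.

Definition star_dedekind (D : idomainType)
    (star : set {fraction D} -> set {fraction D}) : Prop :=
  star_noetherian star /\ PstarMD star.

Definition comaximal (D : idomainType)
    (star : set {fraction D} -> set {fraction D}) (A B : set {fraction D}) : Prop :=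
  star (addm A B) = star (Dset D).

Definition factorization (D : idomainType)
    (star : set {fraction D} -> set {fraction D}) (I : set {fraction D})
    (n : nat) (P : 'I_n -> set {fraction D}) (e : 'I_n -> nat) : Prop :=
  [/\ forall i, quasi_prime (star_f star) (P i),
      forall i j, i != j -> comaximal (star_f star) (P i) (P j)
    & star_tilde star I =
      star_tilde star (\big[@mulm D/Dset D]_(i < n) expm (P i) (e i))].

Definition reduced_factorization (D : idomainType)
    (star : set {fraction D} -> set {fraction D}) (I : set {fraction D})
    (n : nat) (P : 'I_n -> set {fraction D}) (e : 'I_n -> nat) : Prop :=
  [/\ factorization star I P e,
      forall i, star_tilde star (P i) <> star_tilde star (Dset D)
    & forall i, (0 < e i)%N].

Definition has_factorizations (D : idomainType)
    (star : set {fraction D} -> set {fraction D}) : Prop :=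
  forall I, nz_ideal I ->
    exists (n : nat) (P : 'I_n -> set {fraction D}) (e : 'I_n -> nat),
      factorization star I P e.

(* Main.v *)
Require Import Defs.
From mathcomp Require Import all_boot all_order all_algebra.
From mathcomp Require Import boolp classical_sets functions cardinality.
From mathcomp Require Import ring.

(* Both conditions are equivalent to: every D_Q with Q in M(star_f) is a      *)
(* discrete valuation ring, and every nonzero ideal lies in only finitely     *)
(* many Q. Given this, the quasi-star_f-primes are the elements of M(star_f), *)
(* which are pairwise comaximal, and the exponent of Q in the factorization   *)
(* of I is the valuation of I at Q; this yields existence and uniqueness.     *)
(* If D is a star-DD, then I^star /\ D and I^~ /\ D agree, so that each D_Q   *)
(* is a local principal ideal domain; infinitely many Q containing x would    *)
(* give a strictly increasing chain of quasi-star-ideals, by localizing xD at *)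
(* fewer and fewer Q.                                                         *)
(* Conversely, given factorizations, comaximality leaves at most one factor   *)
(* at each Q, so every nonzero x in Q satisfies xD_Q = (PD_Q)^e for a prime P *)
(* and e > 0, whence PD_Q is principal. Comparing x, a and xa shows that P    *)
(* does not depend on x, so that P = Q and D_Q is a discrete valuation ring.  *)

Set Implicit Arguments.
Unset Strict Implicit.
Unset Printing Implicit Defensive.
Import GRing.Theory.
Local Open Scope ring_scope.
Local Open Scope classical_set_scope.

(** The bridge between closures and local rings is [tilde_eq_loc] with its converse [eq_tilde]: two
    submodules have the same tilde closure exactly when they have the same localization at every Q
    in M(star_f). Factorizations thus become statements about each D_Q separately, where ideals are
    handled through generators ([loc_gen]) up to units.

    The key algebraic fact is [loc_gen_factors]: if a product is principal at Q, so is each factor.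
    Applied to a factorization of xD, it makes a prime inside Q principal at Q, and
    [factorizations_uniformizer] deduces that D_Q is a discrete valuation ring. In the Dedekind
    case, [star_sub_loc] shows that star does not enlarge finitely generated ideals locally, whence
    [dedekind_locally_dvr] and [dedekind_finite_character]. In the other direction, local
    information is glued by [star_f_loc] and [eq_tilde], and finite character leaves only finitely
    many Q to control. *)

(** * Submodules of K, nonzero ideals and finite generation *)

Section Submodules.
Variable D : idomainType.
Local Notation K := {fraction D}.
Local Notation R := (Dset D).
Implicit Types (E F G A B I J P Q : set K) (x y z s t : K).

Lemma Dset0 : R 0.
Proof. by exists 0; rewrite ?tofrac0. Qed.

Lemma Dset1 : R 1.
Proof. by exists 1; rewrite ?tofrac1. Qed.

Lemma DsetD x y : R x -> R y -> R (x + y).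
Proof. by move=> [a _ <-] [b _ <-]; exists (a + b); rewrite ?tofracD. Qed.

Lemma DsetM x y : R x -> R y -> R (x * y).
Proof. by move=> [a _ <-] [b _ <-]; exists (a * b); rewrite ?tofracM. Qed.

Lemma DsetX x n : R x -> R (x ^+ n).
Proof.
move=> Rx; elim: n => [|n IHn]; first by rewrite expr0; exact: Dset1.
by rewrite exprS; exact: DsetM.
Qed.

Lemma submodule_Dset : submodule R.
Proof. by split; [exact: Dset0 | exact: DsetD | exact: DsetM]. Qed.

Lemma nonzero_Dset : nonzero R.
Proof. by exists 1; [exact: Dset1 | exact: oner_neq0]. Qed.

Lemma Fbar_Dset : Fbar D R.
Proof. by split; [exact: submodule_Dset | exact: nonzero_Dset]. Qed.

Lemma nz_ideal_Dset : nz_ideal R.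
Proof. by split; [exact: Fbar_Dset |]. Qed.

Lemma submodule_sum E n (f : 'I_n -> K) :
  submodule E -> (forall i, E (f i)) -> E (\sum_i f i).
Proof. by case=> E0 ED _ Ef; apply: big_ind. Qed.

Lemma nonzeroS E F : E `<=` F -> nonzero E -> nonzero F.
Proof. by move=> EF [x /EF Fx x0]; exists x. Qed.

Lemma ideal1 I : submodule I -> I `<=` R -> I 1 -> I = R.
Proof.
move=> [_ _ IM] IR I1; apply/seteqP; split=> // x Rx.
by rewrite -[x]mulr1; exact: IM.
Qed.

Lemma submodule_dilate x E : submodule E -> submodule (dilate x E).
Proof.
move=> [E0 ED EM]; split; first by exists 0; rewrite ?mulr0.
- by move=> _ _ [y Ey <-] [z Ez <-]; exists (y + z); rewrite ?mulrDr//; exact: ED.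
- by move=> a _ Ra [y Ey <-]; exists (a * y); rewrite 1?mulrCA//; exact: EM.
Qed.

Lemma Fbar_dilate x E : x != 0 -> Fbar D E -> Fbar D (dilate x E).
Proof.
move=> x0 [sE [y Ey y0]]; split; first exact: submodule_dilate.
by exists (x * y); [exists y | rewrite mulf_neq0].
Qed.

Lemma dilate_sub x E F : submodule F -> E `<=` R -> F x -> dilate x E `<=` F.
Proof. by move=> [_ _ FM] ER Fx _ [y /ER Ry <-]; rewrite mulrC; exact: FM. Qed.

Lemma dilate1 x : dilate x R x.
Proof. by exists 1; [exact: Dset1 | rewrite mulr1]. Qed.

Lemma Fbar_principal x : x != 0 -> Fbar D (dilate x R).
Proof. by move=> x0; exact: Fbar_dilate x0 Fbar_Dset. Qed.

Lemma nz_ideal_principal x : R x -> x != 0 -> nz_ideal (dilate x R).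
Proof.
move=> Rx x0; split; first exact: Fbar_principal.
by apply: dilate_sub => //; exact: submodule_Dset.
Qed.

Lemma submodule_addm A B : submodule A -> submodule B -> submodule (addm A B).
Proof.
move=> [A0 AD AM] [B0 BD BM]; split.
- by exists 0 => //; exists 0; rewrite ?addr0.
- move=> _ _ [a Aa [b Bb <-]] [c Ac [d Bd <-]].
  by exists (a + c); [exact: AD | exists (b + d); [exact: BD | rewrite addrACA]].
- move=> r _ Rr [a Aa [b Bb <-]].
  by exists (r * a); [exact: AM | exists (r * b); [exact: BM | rewrite mulrDr]].
Qed.

Lemma addmSl A B : submodule B -> A `<=` addm A B.
Proof. by move=> [B0 _ _] a Aa; exists a => //; exists 0; rewrite ?addr0. Qed.

Lemma addmSr A B : submodule A -> B `<=` addm A B.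
Proof. by move=> [A0 _ _] b Bb; exists 0 => //; exists b; rewrite ?add0r. Qed.

Lemma addm_sub A B E : submodule E -> A `<=` E -> B `<=` E -> addm A B `<=` E.
Proof. by move=> [_ ED _] AE BE _ [a /AE Ea [b /BE Eb <-]]; exact: ED. Qed.

Lemma Fbar_addm A B : Fbar D A -> submodule B -> Fbar D (addm A B).
Proof.
move=> [sA nA] sB; split; first exact: submodule_addm.
by apply: nonzeroS nA; exact: addmSl.
Qed.

Lemma mulm_sub A B E : submodule E ->
  (forall x y, A x -> B y -> E (x * y)) -> mulm A B `<=` E.
Proof.
by move=> sE ABE _ [n [x [y [Ax By ->]]]]; apply: submodule_sum => // i; exact: ABE.
Qed.

Lemma mulm_mul A B x y : A x -> B y -> mulm A B (x * y).
Proof.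
move=> Ax By; exists 1%N, (fun=> x), (fun=> y); split=> //.
by rewrite big_ord1.
Qed.

Lemma submodule_mulm A B : submodule A -> submodule B -> submodule (mulm A B).
Proof.
move=> [A0 _ AM] [B0 _ _]; split.
- by rewrite -[0](mulr0 0); exact: mulm_mul.
- move=> _ _ [n [a [b [Aa Bb ->]]]] [m [c [d [Ac Bd ->]]]].
  exists (n + m)%N,
    (fun i => match fintype.split i with inl j => a j | inr j => c j end),
    (fun i => match fintype.split i with inl j => b j | inr j => d j end).
  split; [by move=> i; case: fintype.split.. |].
  rewrite big_split_ord; congr (_ + _); apply: eq_bigr => i _.
    by rewrite (unsplitK (inl i)).
  by rewrite (unsplitK (inr i)).
- move=> r _ Rr [n [a [b [Aa Bb ->]]]]; exists n, (fun i => r * a i), b; split=> //.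
    by move=> i; exact: AM.
  by rewrite mulr_sumr; apply: eq_bigr => i _; rewrite mulrA.
Qed.

Lemma nz_ideal_mulm A B : nz_ideal A -> nz_ideal B -> nz_ideal (mulm A B).
Proof.
move=> [[sA [a Aa a0]] AR] [[sB [b Bb b0]] BR]; split; last first.
  by apply: mulm_sub; [exact: submodule_Dset | move=> x y /AR ? /BR ?; exact: DsetM].
split; first exact: submodule_mulm.
by exists (a * b); [exact: mulm_mul | rewrite mulf_neq0].
Qed.

Lemma nz_ideal_expm A e : nz_ideal A -> nz_ideal (expm A e).
Proof.
move=> nA; elim: e => [|e IHe]; first exact: nz_ideal_Dset.
exact: nz_ideal_mulm.
Qed.

Lemma nz_ideal_big (T : Type) (r : seq T) (A : T -> set K) :
  (forall i, nz_ideal (A i)) -> nz_ideal (\big[@mulm D/Dset D]_(i <- r) A i).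
Proof.
move=> nA; elim: r => [|i r IHr]; first by rewrite big_nil; exact: nz_ideal_Dset.
by rewrite big_cons; exact: nz_ideal_mulm.
Qed.

Lemma submodule_dspan n (g : 'I_n -> K) : submodule (dspan g).
Proof.
split.
- exists (fun=> 0) => [_|]; first exact: Dset0.
  by rewrite big1 // => i _; rewrite mul0r.
- move=> _ _ [a Ra ->] [b Rb ->]; exists (fun i => a i + b i) => [i|].
    exact: DsetD.
  by rewrite -big_split; apply: eq_bigr => i _; rewrite mulrDl.
- move=> r _ Rr [a Ra ->]; exists (fun i => r * a i) => [i|]; first exact: DsetM.
  by rewrite mulr_sumr; apply: eq_bigr => i _; rewrite mulrA.
Qed.

Lemma dspan_gen n (g : 'I_n -> K) i : dspan g (g i).
Proof.
exists (fun j => (j == i)%:R) => [j|].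
  by case: (j == i); [exact: Dset1 | exact: Dset0].
rewrite (bigD1 i) //= eqxx mul1r big1 ?addr0 // => j /negPf ->.
by rewrite mul0r.
Qed.

Lemma dspan_sub n (g : 'I_n -> K) E :
  submodule E -> (forall i, E (g i)) -> dspan g `<=` E.
Proof.
move=> sE Eg _ [a Ra ->]; apply: submodule_sum => // i.
by case: sE => _ _; apply.
Qed.

Lemma fin_gen_principal x : fin_gen (dilate x R).
Proof.
exists 1%N, (fun=> x); apply/seteqP; split.
  apply: dilate_sub => //; first exact: submodule_dspan.
  exact: (@dspan_gen 1 (fun=> x) ord0).
apply: dspan_sub => [|_]; last exact: dilate1.
by apply: submodule_dilate; exact: submodule_Dset.
Qed.

Lemma fin_gen_addm A B : fin_gen A -> fin_gen B -> fin_gen (addm A B).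
Proof.
move=> [n [g ->]] [m [h ->]]; exists (n + m)%N.
pose gh (i : 'I_(n + m)) :=
  match fintype.split i with inl j => g j | inr j => h j end.
exists gh; apply/seteqP; split.
  apply: addm_sub; first exact: submodule_dspan.
  - apply: dspan_sub => [|i]; first exact: submodule_dspan.
    by have := dspan_gen gh (lshift m i); rewrite /gh (unsplitK (inl i)).
  - apply: dspan_sub => [|i]; first exact: submodule_dspan.
    by have := dspan_gen gh (rshift n i); rewrite /gh (unsplitK (inr i)).
apply: dspan_sub => [|i].
  by apply: submodule_addm; exact: submodule_dspan.
rewrite /gh; case: fintype.split => j.
  by apply: addmSl; [exact: submodule_dspan | exact: dspan_gen].
by apply: addmSr; [exact: submodule_dspan | exact: dspan_gen].
Qed.

Lemma fgFbar_principal x : x != 0 -> fgFbar D (dilate x R).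
Proof. by split; [exact: Fbar_principal | exact: fin_gen_principal]. Qed.

Lemma fgFbar_addm A B : fgFbar D A -> fgFbar D B -> fgFbar D (addm A B).
Proof.
move=> [FA gA] [[sB _] gB]; split; [exact: Fbar_addm | exact: fin_gen_addm].
Qed.

Lemma fgFbar_bound n (G : 'I_n -> set K) E : Fbar D E ->
  (forall i, fgFbar D (G i) /\ G i `<=` E) ->
  exists H, [/\ fgFbar D H, H `<=` E & forall i, G i `<=` H].
Proof.
move=> [sE [x Ex x0]]; elim: n G => [|n IHn] G fG.
  (* The empty family also needs a nonzero bound, since [fgFbar] excludes 0. *)
  exists (dilate x R); split=> [||[]//]; first exact: fgFbar_principal.
  exact: dilate_sub.
have [H [fH HE GH]] := IHn _ (fun i => fG (lift ord0 i)).
have [fG0 G0E] := fG ord0.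
exists (addm (G ord0) H); split; [exact: fgFbar_addm | exact: addm_sub |].
move=> i; case: (unliftP ord0 i) => [j|] ->.
  by apply: subset_trans (GH j) _; apply: addmSr; case: fG0 => -[].
by apply: addmSl; case: fH => -[].
Qed.

Lemma inv_ideal_submodule I : submodule (inv_ideal I).
Proof.
split.
- by move=> _ [y _ <-]; rewrite mul0r; exact: Dset0.
- move=> x y xI yI _ [z Iz <-]; rewrite mulrDl.
  by apply: DsetD; [apply: xI | apply: yI]; exists z.
- move=> a x Ra xI _ [z Iz <-]; rewrite -mulrA.
  by apply: DsetM => //; apply: xI; exists z.
Qed.

Lemma inv_idealP I x y : I x -> inv_ideal I y -> R (x * y).
Proof. by move=> Ix Iy; rewrite mulrC; apply: Iy; exists x. Qed.

Lemma inv_ideal1 I : I `<=` R -> inv_ideal I 1.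
Proof. by move=> IR _ [z /IR Rz <-]; rewrite mul1r. Qed.

(** With [J = L] this is the ideal that invertibility speaks of; a larger [L] arises when one
    element is adjoined to J. The product contains J because 1 lies in L^-1. *)
Lemma nz_ideal_mul_inv J L : nz_ideal J -> J `<=` L -> L `<=` R ->
  nz_ideal (mulm J (inv_ideal L)).
Proof.
move=> [[sJ [x Jx x0]] JR] JL LR; split; last first.
  apply: mulm_sub => [|a b /JL La]; first exact: submodule_Dset.
  exact: inv_idealP.
split; first by apply: submodule_mulm => //; exact: inv_ideal_submodule.
by exists x => //; rewrite -[x]mulr1; apply: mulm_mul => //; exact: inv_ideal1.
Qed.

End Submodules.

(** * Localization at a prime, and ideals that are principal there *)

Section Localization.
Variable D : idomainType.
Local Notation K := {fraction D}.
Local Notation R := (Dset D).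
Implicit Types (E F G A B I J P Q : set K) (x y z s t : K).

(* The localization E D_Q, in a form in which denominators can be cleared. *)
Definition loc Q E : set K := [set z | exists2 s, (R `\` Q) s & E (s * z)].

(** This is xD_Q = yD_Q, the unit of D_Q being a quotient of elements of D outside Q. *)
Definition associated Q x y :=
  exists s t, [/\ (R `\` Q) s, (R `\` Q) t & s * x = t * y].

(* E D_Q = x D_Q *)
Definition loc_gen Q E x := loc Q E x /\ E `<=` loc Q (dilate x R).

Section AtPrime.
Variable Q : set K.
Hypothesis primeQ : prime_ideal Q.
Local Notation U := (R `\` Q).

Lemma prime_mul x y : Q x -> R y -> Q (x * y).
Proof. by case: primeQ => -[_ _ QM] _ _ _ Qx Ry; rewrite mulrC; exact: QM. Qed.

Lemma units1 : U 1.
Proof.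
split; first exact: Dset1.
by case: primeQ => sQ QR QneqR _ Q1; apply: QneqR; exact: ideal1.
Qed.

Lemma unitsM x y : U x -> U y -> U (x * y).
Proof.
move=> [Rx nQx] [Ry nQy]; split; first exact: DsetM.
by case: primeQ => _ _ _ QP /QP[].
Qed.

Lemma unitsMr x y : R x -> R y -> U (x * y) -> U x.
Proof. by move=> Rx Ry [_ nQ]; split=> // Qx; apply: nQ; exact: prime_mul. Qed.

Lemma unitsX x n : U x -> U (x ^+ n).
Proof.
move=> Ux; elim: n => [|n IHn]; first by rewrite expr0; exact: units1.
by rewrite exprS; exact: unitsM.
Qed.

Lemma units_neq0 x : U x -> x != 0.
Proof.
by move=> [_ nQx]; apply/eqP => x0; apply: nQx; rewrite x0; case: primeQ => -[].
Qed.

Lemma prime_cancel x y : R x -> R y -> ~ Q x -> Q (x * y) -> Q y.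
Proof. by case: primeQ => _ _ _ QP Rx Ry nQx /QP[]. Qed.

Lemma prime_root x n : R x -> Q (x ^+ n) -> Q x.
Proof. by move=> Rx Qxn; apply: contrapT => nQx; have [] := unitsX n (conj Rx nQx). Qed.

Lemma submodule_loc E : submodule E -> submodule (loc Q E).
Proof.
move=> [E0 ED EM]; split.
- by exists 1; [exact: units1 | rewrite mulr0].
- move=> x y [s Us Ex] [t Ut Ey]; exists (s * t); first exact: unitsM.
  rewrite mulrDr; apply: ED.
    by rewrite mulrAC mulrC; apply: EM => //; case: Ut.
  by rewrite -mulrA; apply: EM => //; case: Us.
- by move=> a x Ra [s Us Ex]; exists s; rewrite 1?mulrCA//; exact: EM.
Qed.

Lemma sub_loc E : E `<=` loc Q E.
Proof. by move=> x Ex; exists 1; [exact: units1 | rewrite mul1r]. Qed.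

Lemma locS E F : E `<=` F -> loc Q E `<=` loc Q F.
Proof. by move=> EF x [s Us /EF Fx]; exists s. Qed.

Lemma loc_unit E s x : U s -> loc Q E (s * x) -> loc Q E x.
Proof.
by move=> Us [t Ut E_]; exists (t * s); [exact: unitsM | rewrite -mulrA].
Qed.

Lemma loc_sub E F : E `<=` loc Q F -> loc Q E `<=` loc Q F.
Proof. by move=> EF x [s Us /EF]; exact: loc_unit. Qed.

Lemma loc_prime x : R x -> loc Q Q x -> Q x.
Proof. by case: primeQ => _ _ _ QP Rx [s [Rs nQs] /QP[]]. Qed.

Lemma mulm_localization E : submodule E -> mulm E (localization Q) = loc Q E.
Proof.
move=> sE; apply/seteqP; split.
  apply: mulm_sub; first exact: submodule_loc.
  move=> x _ Ex [a Ra [s Us <-]]; exists s => //.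
  have s0 := units_neq0 Us.
  have -> : s * (x * (a / s)) = a * x by rewrite mulrCA [s * _]mulrC divfK // mulrC.
  by case: sE => _ _; apply.
move=> z [s Us Esz]; have s0 := units_neq0 Us.
have -> : z = (s * z) * (1 / s) by rewrite mul1r mulrC mulKf.
apply: mulm_mul => //; exists 1; first exact: Dset1.
by exists s.
Qed.

Lemma associated_refl x : associated Q x x.
Proof. by exists 1, 1; split=> //; exact: units1. Qed.

Lemma associated_sym x y : associated Q x y -> associated Q y x.
Proof. by move=> [s [t [Us Ut e]]]; exists t, s. Qed.

Lemma associated_trans x y z :
  associated Q x y -> associated Q y z -> associated Q x z.
Proof.
move=> [s [t [Us Ut e]]] [s' [t' [Us' Ut' e']]].
exists (s' * s), (t * t'); split; [exact: unitsM | exact: unitsM |].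
by rewrite -!mulrA e -e' mulrCA.
Qed.

Lemma associatedM x y x' y' :
  associated Q x y -> associated Q x' y' -> associated Q (x * x') (y * y').
Proof.
move=> [s [t [Us Ut e]]] [s' [t' [Us' Ut' e']]].
exists (s * s'), (t * t'); split; [exact: unitsM | exact: unitsM |].
by rewrite mulrACA e e' mulrACA.
Qed.

Lemma associatedX x y n : associated Q x y -> associated Q (x ^+ n) (y ^+ n).
Proof.
move=> xy; elim: n => [|n IHn]; first exact: associated_refl.
by rewrite !exprS; exact: associatedM.
Qed.

Lemma associated_cancel x y z :
  z != 0 -> associated Q (z * x) (z * y) -> associated Q x y.
Proof.
move=> z0 [s [t [Us Ut e]]]; exists s, t; split=> //.
by apply: (mulfI z0); rewrite mulrCA e mulrCA.
Qed.

Lemma associated_unit x : U x -> associated Q x 1.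
Proof.
by move=> Ux; exists 1, x; split=> //; [exact: units1 | rewrite mul1r mulr1].
Qed.

Lemma associated_prime x y : R x -> R y -> associated Q x y -> Q x -> Q y.
Proof.
move=> Rx Ry [s [t [[Rs _] Ut e]]] Qx; apply: (loc_prime Ry).
by exists t => //; rewrite -e mulrC; exact: prime_mul.
Qed.

(** From s y = x a and t x = y b, cancelling x gives ab = st, so a is outside Q. *)
Lemma associated_dvd x y :
  loc Q (dilate x R) y -> loc Q (dilate y R) x -> x != 0 -> associated Q x y.
Proof.
move=> [s Us [a Ra xa]] [t Ut [b Rb yb]] x0.
exists a, s; split=> //; last by rewrite mulrC.
apply: (@unitsMr a b) => //; have -> : a * b = s * t; last exact: unitsM.
by apply: (mulfI x0); rewrite mulrA xa -mulrA yb [RHS]mulrC mulrA.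
Qed.

Lemma associated_loc E x y : submodule E ->
  associated Q x y -> loc Q E x -> loc Q E y.
Proof.
move=> sE [s [t [[Rs _] Ut e]]] lEx; apply: (loc_unit Ut); rewrite -e.
by case: (submodule_loc sE) => _ _; apply.
Qed.

Lemma associated_dilate x y : associated Q x y -> loc Q (dilate x R) y.
Proof.
move=> [s [t [[Rs _] Ut e]]]; exists t => //; rewrite -e.
by exists s => //; rewrite mulrC.
Qed.

Lemma dvd_trans x y z :
  loc Q (dilate x R) y -> loc Q (dilate y R) z -> loc Q (dilate x R) z.
Proof.
move=> xy; apply: loc_sub; apply: dilate_sub => //.
by apply: submodule_loc; apply: submodule_dilate; exact: submodule_Dset.
Qed.

Lemma loc_gen_loc E x : submodule E -> loc_gen Q E x ->
  loc Q E = loc Q (dilate x R).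
Proof.
move=> sE [lEx Ex]; apply/seteqP; split; first exact: loc_sub.
by apply: loc_sub; apply: dilate_sub => //; exact: submodule_loc.
Qed.

Lemma eq_loc_gen E F x : loc Q E = loc Q F -> loc_gen Q E x -> loc_gen Q F x.
Proof.
move=> EF [lEx Ex]; split; first by rewrite -EF.
by apply: subset_trans (sub_loc (E:=F)) _; rewrite -EF; exact: loc_sub.
Qed.

Lemma loc_gen_associated E x y : x != 0 ->
  loc_gen Q E x -> loc_gen Q E y -> associated Q x y.
Proof.
move=> x0 [lEx Ex] [lEy Ey]; apply: associated_dvd => //.
  exact: (loc_sub Ex).
exact: (loc_sub Ey).
Qed.

Lemma associated_loc_gen E x y : submodule E ->
  associated Q x y -> loc_gen Q E x -> loc_gen Q E y.
Proof.
move=> sE xy [lEx Ex]; split; first exact: associated_loc lEx.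
move=> z /Ex xz; apply: dvd_trans xz.
exact: associated_dilate (associated_sym xy).
Qed.

Lemma loc_gen_principal x : loc_gen Q (dilate x R) x.
Proof. by split; [apply: sub_loc; exact: dilate1 | exact: sub_loc]. Qed.

Lemma loc_gen_Dset : loc_gen Q R 1.
Proof.
split; first by apply: sub_loc; exact: Dset1.
by move=> x Rx; apply: sub_loc; exists x; rewrite ?mul1r.
Qed.

Lemma loc_gen_one I : I `<=` R -> ~ (I `<=` Q) -> loc_gen Q I 1.
Proof.
move=> IR /existsNP[x /not_implyP[Ix nQx]]; split.
  by exists x; [split=> //; exact: IR | rewrite mulr1].
by move=> y /IR Ry; apply: sub_loc; exists y; rewrite ?mul1r.
Qed.

Lemma loc_gen_mul A B x y :
  loc_gen Q A x -> loc_gen Q B y -> loc_gen Q (mulm A B) (x * y).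
Proof.
move=> [[s Us Ax] xA] [[t Ut By] yB]; split.
  by exists (s * t); [exact: unitsM | rewrite mulrACA; exact: mulm_mul].
apply: mulm_sub.
  by apply: submodule_loc; apply: submodule_dilate; exact: submodule_Dset.
move=> a b /xA[s' Us' [c Rc ac]] /yB[t' Ut' [d Rd bd]].
exists (s' * t'); first exact: unitsM.
by exists (c * d); [exact: DsetM | rewrite mulrACA ac bd mulrACA].
Qed.

Lemma loc_gen_exp A x e : loc_gen Q A x -> loc_gen Q (expm A e) (x ^+ e).
Proof.
move=> Ax; elim: e => [|e IHe]; first exact: loc_gen_Dset.
by rewrite exprS; exact: loc_gen_mul.
Qed.

Lemma loc_gen_big (T : Type) (r : seq T) (A : T -> set K) (x : T -> K) :
  (forall i, loc_gen Q (A i) (x i)) ->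
  loc_gen Q (\big[@mulm D/Dset D]_(i <- r) A i) (\prod_(i <- r) x i).
Proof.
move=> Ax; apply: (big_rec2 (loc_gen Q)) => [|i B y _ By].
  exact: loc_gen_Dset.
exact: loc_gen_mul.
Qed.

(* The generator x of (AB)D_Q is, up to a unit, a combination of products of  *)
(* A and B, so one of these products generates.                               *)
Lemma loc_gen_factors A B x : submodule A -> submodule B -> x != 0 ->
  loc_gen Q (mulm A B) x ->
  exists a b, [/\ A a, B b, loc_gen Q A a & loc_gen Q B b].
Proof.
move=> sA sB x0 [[s Us [n [a [b [Aa Bb sx]]]]] ABx].
have ab i : exists2 t, U t & dilate x R (t * (a i * b i)).
  by apply: ABx; exact: mulm_mul.
have [t Ut tab] : exists2 t, U t & forall i, dilate x R (t * (a i * b i)).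
  have [t tP] :=
    choice (fun i => let: ex_intro2 t p q := ab i in ex_intro _ t (conj p q)).
  exists (\prod_i t i).
    by apply: big_ind => [||i _]; [exact: units1 | exact: unitsM | case: (tP i)].
  move=> i; rewrite (bigD1 i) //= mulrAC mulrC.
  have [_ _ dM] := submodule_dilate x (submodule_Dset D).
  apply: dM; last by case: (tP i).
  apply: big_ind => [||j _]; [exact: Dset1 | exact: DsetM |].
  by case: (tP j) => -[].
have {ab}[d dP] :=
  choice (fun i => let: ex_intro2 t p q := tab i in ex_intro _ t (conj p q)).
(* Dividing t s x by x writes the unit t s as the sum of the [d i]; they cannot all lie in Q. *)
have tsd : t * s = \sum_i d i.
  apply: (mulfI x0); rewrite mulr_sumr.
  transitivity (t * (s * x)); first by ring.
  by rewrite sx mulr_sumr; apply: eq_bigr => i _; case: (dP i) => _ ->.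
have [i Ui] : exists i, U (d i).
  apply: contrapT => /forallNP nU.
  have [_ nQts] : U (t * s) by exact: unitsM.
  apply: nQts; rewrite tsd; apply: submodule_sum => [|i]; first by case: primeQ.
  by apply: contrapT => nQd; apply: (nU i); split=> //; case: (dP i).
have [_ xd] := dP i.
have dx0 : x * d i != 0 by rewrite mulf_neq0 // units_neq0.
have [a0 b0] : a i != 0 /\ b i != 0.
  by move: dx0; rewrite xd !mulf_eq0 !negb_or => /and3P[].
exists (a i), (b i); split=> //; split; [exact: sub_loc| |exact: sub_loc|].
  (* In D_Q, c b_i is a multiple of x, and x is a unit times a_i b_i; cancelling b_i makes c a
     multiple of a_i. *)
  move=> c Ac; have [r Ur [g Rg xg]] := ABx _ (mulm_mul Ac (Bb i)).
  exists (d i * r); first exact: unitsM.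
  exists (t * g); first by apply: DsetM => //; case: Ut.
  apply: (mulIf b0); transitivity (t * (a i * b i) * g); first by ring.
  by rewrite -xd; transitivity (d i * (x * g)); [ring | rewrite xg; ring].
move=> c Bc; have [r Ur [g Rg xg]] := ABx _ (mulm_mul (Aa i) Bc).
exists (d i * r); first exact: unitsM.
exists (t * g); first by apply: DsetM => //; case: Ut.
apply: (mulfI a0); transitivity (t * (a i * b i) * g); first by ring.
by rewrite -xd; transitivity (d i * (x * g)); [ring | rewrite xg; ring].
Qed.

Lemma loc_gen_neq0 E x : nonzero E -> loc_gen Q E x -> x != 0.
Proof.
move=> [y Ey y0] [_ /(_ y Ey)[s Us [a _ e]]].
by move: (mulf_neq0 (units_neq0 Us) y0); rewrite -e mulf_eq0 negb_or => /andP[].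
Qed.

Lemma common_denominator F E : submodule E -> fin_gen F -> F `<=` loc Q E ->
  exists2 s, U s & forall z, F z -> E (s * z).
Proof.
move=> sE [n [g ->]] FE.
have gE i : exists t, U t /\ E (t * g i).
  by have [t Ut Et] := FE _ (dspan_gen g i); exists t.
have [t tP] := choice gE; exists (\prod_i t i).
  by apply: big_ind => [||i _]; [exact: units1 | exact: unitsM | case: (tP i)].
suff : dspan g `<=` [set z | E ((\prod_i t i) * z)] by [].
have [E0 ED EM] := sE.
apply: dspan_sub.
  split=> [|x y /= Ex Ey|a x Ra /= Ex] /=; first by rewrite mulr0.
    by rewrite mulrDr; exact: ED.
  by rewrite mulrCA; exact: EM.
move=> i /=; rewrite (bigD1 i) //= mulrAC mulrC.
apply: EM; last by case: (tP i).
apply: big_ind => [||j _]; [exact: Dset1 | exact: DsetM |].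
by case: (tP j) => -[].
Qed.

End AtPrime.
End Localization.

(** * The operation star_f and its quasi-maximal ideals *)

Section Semistar.
Variable D : idomainType.
Variable star : set {fraction D} -> set {fraction D}.
Hypothesis Hstar : semistar star.
Local Notation K := {fraction D}.
Local Notation R := (Dset D).
Local Notation sf := (star_f star).
Implicit Types (E F G A B I J L P Q : set K) (x y z s t : K).

Lemma star_Fbar E : Fbar D E -> Fbar D (star E).
Proof. by case: Hstar => H _ _ _ _; exact: H. Qed.

Lemma star_mono E F : Fbar D E -> Fbar D F -> E `<=` F -> star E `<=` star F.
Proof. by case: Hstar => _ _ H _ _; exact: H. Qed.

Lemma sub_star E : Fbar D E -> E `<=` star E.
Proof. by case: Hstar => _ _ _ H _; exact: H. Qed.

Lemma star_le E F : Fbar D E -> Fbar D F -> E `<=` star F -> star E `<=` star F.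
Proof.
move=> FE FF EF; case: Hstar => _ _ _ _ /(_ F FF) idem; rewrite -idem.
by apply: star_mono => //; exact: star_Fbar.
Qed.

Lemma star_mul E x z : Fbar D E -> star E z -> x != 0 ->
  star (dilate x E) (x * z).
Proof. by move=> FE Ez x0; case: Hstar => _ H _ _ _; rewrite H//; exists z. Qed.

Lemma star_sub_f E F : E `<=` F -> sf E `<=` sf F.
Proof.
move=> EF x [G [fG GE] Gx]; exists G => //.
by split=> //; exact: subset_trans EF.
Qed.

Lemma star_f_le E : Fbar D E -> sf E `<=` star E.
Proof. by move=> FE x [G [[FG _] GE]]; exact: star_mono. Qed.

(** Each generator of F needs one finitely generated submodule of E, and finitely many of these have
    a common bound. This gives the idempotence of star_f. *)
Lemma star_f_approx F E : Fbar D E -> fin_gen F -> F `<=` sf E ->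
  exists H, [/\ fgFbar D H, H `<=` E & F `<=` star H].
Proof.
move=> FE [n [g ->]] FsE.
have gE i : exists G, [/\ fgFbar D G, G `<=` E & star G (g i)].
  by have [G [fG GE] Gg] := FsE _ (dspan_gen g i); exists G.
have [G GP] := choice gE.
have [|H [fH HE GH]] := fgFbar_bound (G := G) FE.
  by move=> i; case: (GP i).
exists H; split=> //; apply: dspan_sub => [|i].
  by case: fH => /star_Fbar[].
have [[FG _] _] := GP i; apply: star_mono => //; by case: fH.
Qed.

Lemma sub_star_f E : Fbar D E -> E `<=` sf E.
Proof.
move=> [sE [y Ey y0]] x Ex.
have sub z : z != 0 -> E z -> star (dilate z R) `<=` sf E.
  move=> z0 Ez t; exists (dilate z R) => //; split; first exact: fgFbar_principal.
  exact: dilate_sub.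
(* The submodule 0D is not in [fgFbar], so 0 is found in the closure of yD. *)
have [x0|x0] := eqVneq x 0.
  by apply: (sub y) => //; rewrite x0; case: (star_Fbar (Fbar_principal y0)) => -[].
by apply: (sub x) => //; apply: sub_star; [exact: Fbar_principal | exact: dilate1].
Qed.

Lemma star_f_Fbar E : Fbar D E -> Fbar D (sf E).
Proof.
move=> FE; split; last by apply: nonzeroS (sub_star_f FE) _; case: FE.
split.
- by apply: sub_star_f => //; case: FE => -[].
- move=> x y [A [fA AE] Ax] [B [fB BE] By].
  have [FA _] := fA; have [FB _] := fB; have fAB := fgFbar_addm fA fB.
  exists (addm A B); first by split=> //; apply: addm_sub => //; case: FE.
  have [FAB _] := fAB; have [[_ sD _] _] := star_Fbar FAB; apply: sD.
    by apply: star_mono Ax => //; apply: addmSl; case: FB.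
  by apply: star_mono By => //; apply: addmSr; case: FA.
- move=> a x Ra [A [fA AE] Ax]; exists A => //.
  by have [FA _] := fA; have [[_ _ sM] _] := star_Fbar FA; exact: sM.
Qed.

Lemma star_f_idem E : Fbar D E -> sf (sf E) `<=` sf E.
Proof.
move=> FE x [F [[FF gF] FsE] Fx].
have [H [fH HE FH]] := star_f_approx FE gF FsE.
exists H => //; apply: star_le FH _ Fx => //; by case: fH.
Qed.

Lemma star_f_mul E x z : sf E z -> x != 0 -> sf (dilate x E) (x * z).
Proof.
move=> [F [[FF [n [g gF]]] FE] Fz] x0; exists (dilate x F).
  split; last by move=> _ [y /FE Ey <-]; exists y.
  split; first exact: Fbar_dilate.
  exists n, (fun i => x * g i); rewrite gF; apply/seteqP; split.
    move=> _ [_ [a Ra ->] <-]; exists a => //; rewrite mulr_sumr.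
    by apply: eq_bigr => i _; rewrite mulrCA.
  move=> _ [a Ra ->]; exists (\sum_i a i * g i); first by exists a.
  by rewrite mulr_sumr; apply: eq_bigr => i _; rewrite mulrCA.
exact: star_mul.
Qed.

Lemma quasi_closure I : nz_ideal I -> quasi_ideal sf (sf I `&` R).
Proof.
move=> [FI IR]; have FsI := star_f_Fbar FI.
have I' : I `<=` sf I `&` R by move=> x Ix; split; [exact: sub_star_f | exact: IR].
have nz : nz_ideal (sf I `&` R).
  split; last by move=> x [].
  split; last by apply: nonzeroS I' _; case: FI.
  case: FsI => -[I0 ID IM] _; have [R0 RD RM] := submodule_Dset D.
  by split=> [//|x y [? ?] [? ?]|a x Ra [? ?]]; split; auto.
split=> //; apply/seteqP; split=> x [sx Rx]; split=> //.
  by apply: sub_star_f => //; case: nz.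
by apply: star_f_idem => //; apply: star_sub_f sx => y [].
Qed.

Lemma quasi_proper I : quasi_ideal sf I -> I <> R -> ~ sf I 1.
Proof.
move=> [[[sI _] IR] Iq] IneqR I1; apply: IneqR; apply: ideal1 => //.
by rewrite Iq; split=> //; exact: Dset1.
Qed.

Section QuasiMaximal.
Variable Q : set K.
Hypothesis maxQ : quasi_maximal sf Q.

Lemma qmax_nz_ideal : nz_ideal Q.
Proof. by case: maxQ => -[]. Qed.

Lemma qmax_star_f1 : ~ sf Q 1.
Proof. by case: maxQ => qQ QR _; exact: quasi_proper. Qed.

(** Maximality of Q is applied to the quasi-closure of I, which is proper because 1 is not in
    I^star_f. *)
Lemma qmax_closure I : nz_ideal I -> Q `<=` I -> ~ sf I 1 -> I `<=` Q.
Proof.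
move=> nI QI nI1; have [FI IR] := nI.
have I' : I `<=` sf I `&` R by move=> x Ix; split; [exact: sub_star_f | exact: IR].
case: maxQ => _ _ /(_ _ (quasi_closure nI)) <- //.
  by move=> IR'; apply: nI1; have [] : (sf I `&` R) 1 by rewrite IR'; exact: Dset1.
exact: subset_trans I'.
Qed.

Lemma qmax_not_sub I : sf I 1 -> ~ (I `<=` Q).
Proof. by move=> I1 IQ; apply: qmax_star_f1; exact: star_sub_f I1. Qed.

(** If ab is in Q and a is not, then 1 lies in (Q + aD)^star_f by maximality; multiplying by b puts
    b in (bQ + abD)^star_f, hence in Q. *)
Lemma qmax_prime : prime_ideal Q.
Proof.
have [[sQ nQ] QR] := qmax_nz_ideal.
split=> //; first by case: maxQ.
move=> a b Ra Rb Qab; apply: contrapT => /not_orP[nQa nQb].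
have sRa : submodule (dilate a R) by apply: submodule_dilate; exact: submodule_Dset.
have QI : Q `<=` addm Q (dilate a R) by exact: addmSl.
have nzI : nz_ideal (addm Q (dilate a R)).
  split; first exact: Fbar_addm.
  apply: addm_sub => //; first exact: submodule_Dset.
  by apply: dilate_sub => //; exact: submodule_Dset.
have I1 : sf (addm Q (dilate a R)) 1.
  apply: contrapT => /(qmax_closure nzI QI) IQ; apply: nQa; apply: IQ.
  by apply: addmSr => //; exact: dilate1.
have b0 : b != 0 by apply/eqP => b0; apply: nQb; rewrite b0; case: sQ.
apply: nQb; have [[_ Qq] _ _] := maxQ; rewrite Qq; split=> //.
rewrite -[b]mulr1; apply: star_sub_f (star_f_mul I1 b0).
have [Q0 QD QM] := sQ.
move=> _ [_ [q Qq' [_ [r Rr <-] <-]] <-]; rewrite mulrDr; apply: QD.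
  exact: QM.
by rewrite mulrA mulrC [b * a]mulrC; exact: QM.
Qed.

End QuasiMaximal.

Lemma qmax_exists I : nz_ideal I -> ~ sf I 1 ->
  exists2 Q, quasi_maximal sf Q & I `<=` Q.
Proof.
move=> nI nI1.
pose good J := [/\ nz_ideal J, I `<=` J & ~ sf J 1].
pose T J := J = set0 \/ good J.
have [|Q [TQ maxQ]] := @Zorn_bigcup K T.
  move=> C CT totC.
  have [C0|] := pselect (forall X, C X -> X = set0).
    left; apply/seteqP; split=> // x [X /C0 ->]; exact.
  move=> /existsNP[X /not_implyP[CX X0]].
  have [//|[[[[X_0 _ _] nX] XR] IX nX1]] := CT X CX.
  have gen Y y : C Y -> Y y -> good Y by move=> /CT[->|].
  right; split.
  - split; last first.
      by move=> x [Y CY Yx]; have [[_ YR] _ _] := gen Y x CY Yx; exact: YR.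
    split; last by apply: nonzeroS nX => x Xx; exists X.
    split; first by exists X.
      move=> x y [Y CY Yx] [Z CZ Zy].
      have [[[[_ YD _] _] _] _ _] := gen Y x CY Yx.
      have [[[[_ ZD _] _] _] _ _] := gen Z y CZ Zy.
      have [YZ|ZY] := totC Y Z CY CZ.
        by exists Z => //; apply: ZD => //; exact: YZ.
      by exists Y => //; apply: YD => //; exact: ZY.
    move=> a x Ra [Y CY Yx]; exists Y => //.
    by have [[[[_ _ YM] _] _] _ _] := gen Y x CY Yx; exact: YM.
  - by move=> x /IX Xx; exists X.
  (* Here finite type matters: a finitely generated F inside the union of a chain lies in one
     member, whose closure would already contain 1. *)
  - move=> [F [[FF [n [g gF]]] FU] F1].
    have [Y CY FY] : exists2 Y, C Y & good Y /\ F `<=` Y.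
      have gU i : exists Y, C Y /\ Y (g i).
        by have [|Y CY Yg] := FU (g i); [rewrite gF; exact: dspan_gen | exists Y].
      suff [Y [CY gY gYi]] : exists Y, [/\ C Y, good Y & forall i, Y (g i)].
        exists Y => //; split=> //; rewrite gF; apply: dspan_sub => //.
        by case: gY => -[[]].
      clear gF FU; elim: n g gU => [|n IHn] g gU.
        exists X; split=> //; last by case.
        by apply: (gen X 0) => //.
      have [Y [CY gY gYi]] := IHn (fun i => g (lift ord0 i)) (fun i => gU _).
      have [Z [CZ Zg]] := gU ord0; have gZ := gen Z _ CZ Zg.
      have [YZ|ZY] := totC Y Z CY CZ.
        exists Z; split=> // i; case: (unliftP ord0 i) => [j|] -> //.
        exact: YZ.
      exists Y; split=> // i; case: (unliftP ord0 i) => [j|] -> //.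
      exact: ZY.
    case: FY => -[nY IY nY1] FY; apply: nY1; exists F => //; split=> //.
    by split=> //; exists n, g.
have gI : good I by split.
have gQ : good Q.
  case: TQ => // Q0; exfalso; apply: (maxQ I); last by right.
  case: nI => -[_ [x Ix _]] _; rewrite Q0; split=> //.
  by move=> /(_ x Ix).
have [nQ IQ nQ1] := gQ; exists Q => //.
have qQ := quasi_closure nQ; have [FQ QR] := nQ.
have QsQ : Q `<=` sf Q `&` R.
  by move=> x Qx; split; [exact: sub_star_f | exact: QR].
have maximal J : good J -> Q `<=` J -> J `<=` Q.
  move=> gJ QJ; apply: contrapT => JQ; apply: (maxQ J); last by right.
  by split.
(* By idempotence the quasi-closure of Q is again [good], so maximality identifies it with Q. *)
have Qq : Q = sf Q `&` R.
  apply/seteqP; split=> //; apply: maximal => //; split.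
  - by case: qQ.
  - exact: subset_trans QsQ.
  - move=> Q1; apply: nQ1; apply: star_f_idem => //.
    by apply: star_sub_f Q1 => x [].
split; first by split.
  by move=> QeqR; apply: nQ1; apply: sub_star_f => //; rewrite QeqR; exact: Dset1.
move=> J qJ JR QJ; apply/seteqP; split=> //; apply: maximal => //; split.
- by case: qJ.
- exact: subset_trans QJ.
- exact: quasi_proper.
Qed.

Lemma qprime_star_f1 P : quasi_prime sf P -> ~ sf P 1.
Proof. by move=> [[_ _ PR _] qP]; exact: quasi_proper. Qed.

(** A lies in its tilde closure, and the tilde closure of B lies in BD_Q. *)
Lemma tilde_eq_loc A B Q : submodule A -> submodule B ->
  star_tilde star A = star_tilde star B -> quasi_maximal sf Q ->
  loc Q A = loc Q B.
Proof.
move=> sA sB; wlog suff sub : A B sA sB / star_tilde star A = star_tilde star B ->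
    quasi_maximal sf Q -> loc Q A `<=` loc Q B.
  by move=> AB qQ; apply/seteqP; split; apply: sub.
move=> AB maxQ; have pQ := qmax_prime maxQ; apply: loc_sub => // x Ax.
rewrite -mulm_localization //; have : star_tilde star A x; last first.
  by rewrite AB => /(_ Q maxQ).
move=> P maxP; have pP := qmax_prime maxP; rewrite mulm_localization //.
exact: sub_loc.
Qed.

Lemma eq_tilde A B : submodule A -> submodule B ->
  (forall Q, quasi_maximal sf Q -> loc Q A = loc Q B) ->
  star_tilde star A = star_tilde star B.
Proof.
move=> sA sB AB; apply: eq_bigcapr => Q /= maxQ; have pQ := qmax_prime maxQ.
by rewrite !mulm_localization // AB.
Qed.

End Semistar.

(** * Discrete valuation rings D_Q *)

Section Uniformizers.
Variable D : idomainType.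
Local Notation K := {fraction D}.
Local Notation R := (Dset D).
Implicit Types (E F G A B I J P Q : set K) (x y z s t : K).

(* For a prime ideal Q, this says that D_Q is a discrete valuation ring with  *)
(* uniformizing element p.                                                    *)
Definition uniformizer Q (p : K) : Prop :=
  [/\ Q p, p != 0
    & forall a, R a -> a != 0 -> exists k, associated Q a (p ^+ k)].

Section AtPrime.
Variables (Q : set K) (p : K).
Hypotheses (primeQ : prime_ideal Q) (unifp : uniformizer Q p).

Let Qp : Q p. Proof. by case: unifp. Qed.
Let p0 : p != 0. Proof. by case: unifp. Qed.
Let QR : Q `<=` R. Proof. by case: primeQ. Qed.
Let Rp : R p. Proof. exact: QR. Qed.

Lemma uniformizer_exp_inj k l : associated Q (p ^+ k) (p ^+ l) -> k = l.
Proof.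
wlog kl : k l / (k < l)%N => [wl|] kAl.
  have [kl|lk|//] := ltngtP k l; first exact: wl.
  by symmetry; apply: wl => //; exact: associated_sym.
case: kAl => s [t [[_ nQs] [Rt _] e]]; case: nQs.
have -> : s = p * (t * p ^+ (l - k).-1).
  apply: (mulIf (expf_neq0 k p0)); rewrite e -{1}(subnK (ltnW kl)).
  rewrite -{1}[(l - k)%N]prednK ?subn_gt0 // exprD exprS; ring.
by apply: (prime_mul primeQ) => //; apply: DsetM => //; exact: DsetX.
Qed.

Lemma uniformizer_dvd k l : (k <= l)%N -> loc Q (dilate (p ^+ k) R) (p ^+ l).
Proof.
move=> kl; apply: (sub_loc primeQ); exists (p ^+ (l - k)); first exact: DsetX.
by rewrite -exprD subnKC.
Qed.

Lemma uniformizer_loc_gen : loc_gen Q Q p.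
Proof.
split=> [|q Qq]; first exact: (sub_loc primeQ).
have sp : submodule (loc Q (dilate p R)).
  by apply: submodule_loc => //; apply: submodule_dilate; exact: submodule_Dset.
have [->|q0] := eqVneq q 0; first by case: sp.
have [_ _ /(_ q (QR Qq) q0)[[|k] qpk]] := unifp.
  have := associated_prime primeQ (QR Qq) (Dset1 D) qpk Qq.
  by case: (units1 primeQ).
have pqk := associated_dilate (associated_sym qpk).
by apply: dvd_trans pqk => //; have := @uniformizer_dvd 1 k.+1 isT; rewrite expr1.
Qed.

(** An element x of I of least valuation k generates ID_Q. Both generators are kept: x lies in I
    itself, while p^k serves to compare valuations. *)
Lemma uniformizer_ideal I : nz_ideal I -> exists x k,
  [/\ I x, loc_gen Q I x, associated Q x (p ^+ k) & loc_gen Q I (p ^+ k)].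
Proof.
move=> [[sI [y Iy y0]] IR].
have exk : exists k, `[< exists x, [/\ I x, x != 0 & associated Q x (p ^+ k)] >].
  by case: unifp => _ _ /(_ y (IR _ Iy) y0)[k yk]; exists k; apply/asboolP; exists y.
case: (ex_minnP exk) => k /asboolP[x [Ix x0 xk]] kmin.
have gx : loc_gen Q I x.
  split=> [|z Iz]; first exact: (sub_loc primeQ).
  have [->|z0] := eqVneq z 0.
    have /(submodule_loc primeQ)[] // : submodule (dilate x R).
    by apply: submodule_dilate; exact: submodule_Dset.
  have [_ _ /(_ z (IR _ Iz) z0)[l zl]] := unifp.
  have kl : (k <= l)%N by apply: kmin; apply/asboolP; exists z.
  apply: (dvd_trans primeQ (associated_dilate xk)).
  apply: (dvd_trans primeQ (uniformizer_dvd kl)).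
  exact: associated_dilate (associated_sym zl).
exists x, k; split=> //; exact: associated_loc_gen xk gx.
Qed.

Lemma uniformizer_loc_gen_inj I k l :
  loc_gen Q I (p ^+ k) -> loc_gen Q I (p ^+ l) -> k = l.
Proof.
move=> Ik Il; apply: uniformizer_exp_inj.
by apply: loc_gen_associated Ik Il => //; rewrite expf_neq0.
Qed.

(** Up to a factor outside Q, hence outside P, some power of p lies in P; so p does, and p generates
    QD_Q. *)
Lemma uniformizer_prime_eq P : prime_ideal P -> nonzero P -> P `<=` Q -> P = Q.
Proof.
move=> primeP nP PQ; have [sP PR _ _] := primeP.
have [x [k [Px _ [s [t [[Rs _] [Rt nQt] e]]] _]]] :
  exists x k, [/\ P x, loc_gen Q P x, associated Q x (p ^+ k) & loc_gen Q P (p ^+ k)].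
  exact: uniformizer_ideal.
have Pp : P p.
  apply: (prime_root primeP (n := k)) => //.
  apply: (@prime_cancel _ _ primeP t) => //; [exact: DsetX | by move/PQ |].
  by rewrite -e mulrC; exact: prime_mul.
apply/seteqP; split=> // q Qq.
have [s' [Rs' nQs'] [a Ra pa]] := uniformizer_loc_gen.2 q Qq.
apply: (@prime_cancel _ _ primeP s') => //; [exact: QR | by move/PQ |].
by rewrite -pa; exact: prime_mul.
Qed.

End AtPrime.
End Uniformizers.

(** * From factorizations to uniformizers *)

Section FactorizationsToValuations.
Variable D : idomainType.
Variable star : set {fraction D} -> set {fraction D}.
Hypothesis Hstar : semistar star.
Local Notation K := {fraction D}.
Local Notation R := (Dset D).
Local Notation sf := (star_f star).
Implicit Types (E F G A B I J P Q : set K) (x y z s t : K).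

Lemma qprime_nz_ideal P : quasi_prime sf P -> nz_ideal P.
Proof. by case=> _ []. Qed.

Lemma comaximal_one A B : comaximal sf A B -> sf (addm A B) 1.
Proof. by move=> ->; apply: sub_star_f (Dset1 D) => //; exact: Fbar_Dset. Qed.

Lemma loc_gen_big_factor (T : eqType) (r : seq T) (A : T -> set K) Q x :
  prime_ideal Q -> (forall i, nz_ideal (A i)) -> x != 0 ->
  loc_gen Q (\big[@mulm D/R]_(i <- r) A i) x ->
  forall i, i \in r -> exists a, loc_gen Q (A i) a.
Proof.
move=> primeQ nA; elim: r x => // j r IHr x x0.
have [[sB nB] _] := nz_ideal_big r nA; have [[sA _] _] := nA j.
rewrite big_cons => /(loc_gen_factors primeQ sA sB x0)[a [b [_ _ Aa Bb]]] i.
rewrite in_cons => /orP[/eqP->|ir]; first by exists a.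
exact: IHr (loc_gen_neq0 primeQ nB Bb) Bb i ir.
Qed.

Lemma loc_gen_exp_factor P Q x e : prime_ideal Q -> nz_ideal P -> (0 < e)%N ->
  loc_gen Q (expm P e) x -> exists2 p, P p & loc_gen Q P p.
Proof.
case: e => // e primeQ nP _ Px; have nPe := nz_ideal_expm e nP.
have [[sP _] _] := nP; have [[sPe _] _] := nPe.
have x0 : x != 0.
  by apply: (loc_gen_neq0 primeQ _ Px); case: (nz_ideal_expm e.+1 nP) => -[].
by have [p [_ [Pp _ gp _]]] := loc_gen_factors primeQ sP sPe x0 Px; exists p.
Qed.

(** By [loc_gen_factors], principality at Q passes from the product to the powers and from a
    positive power to its base. *)
Lemma factorization_loc_gen n (P : 'I_n -> set K) (e : 'I_n -> nat) Q x :
  prime_ideal Q -> (forall i, nz_ideal (P i)) -> x != 0 ->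
  loc_gen Q (\big[@mulm D/R]_(i < n) expm (P i) (e i)) x ->
  exists p : 'I_n -> K,
    [/\ forall i, (0 < e i)%N -> P i (p i) /\ loc_gen Q (P i) (p i),
        forall i, R (p i) & associated Q x (\prod_(i < n) p i ^+ e i)].
Proof.
move=> primeQ nP x0 gx.
have ex i : exists q, [/\ (0 < e i)%N -> P i q /\ loc_gen Q (P i) q, R q
    & loc_gen Q (expm (P i) (e i)) (q ^+ e i)].
  have [e0|e0] := posnP (e i).
    (* A factor with exponent 0 need not be principal at Q; 1 is a placeholder. *)
    exists 1; rewrite e0; split=> //; first exact: Dset1.
    exact: loc_gen_Dset.
  have [j||a ga] :=
    loc_gen_big_factor (A := fun i => expm (P i) (e i)) primeQ _ x0 gx (i := i).
  - exact: nz_ideal_expm.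
  - by rewrite mem_index_enum.
  have [q Pq gq] := loc_gen_exp_factor primeQ (nP i) e0 ga.
  exists q; split=> //; last exact: loc_gen_exp.
  by case: (nP i) => _; exact.
have [p pP] := choice ex; exists p; split=> [i|i|]; try by case: (pP i).
apply: (loc_gen_associated primeQ x0 gx).
by apply: (loc_gen_big primeQ) => i; case: (pP i).
Qed.

Lemma loc_gen_sub P Q p : prime_ideal Q -> P `<=` R -> Q p ->
  loc_gen Q P p -> P `<=` Q.
Proof.
move=> primeQ PR Qp [_ Pp] y Py; have [s Us [a Ra pa]] := Pp y Py.
by apply: (loc_prime primeQ); [exact: PR | exists s => //; rewrite -pa; exact: prime_mul].
Qed.

(* By comaximality only one P_i lies in Q, and at Q the other factors are     *)
(* trivial.                                                                   *)
Lemma loc_prime_power Q x : has_factorizations star -> quasi_maximal sf Q ->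
  Q x -> x != 0 ->
  exists P p e, [/\ prime_ideal P, P `<=` Q, P p, loc_gen Q P p
    & [/\ p != 0, (0 < e)%N & associated Q x (p ^+ e)]].
Proof.
move=> fact maxQ Qx x0; have primeQ := qmax_prime Hstar maxQ.
have Rx : R x by case: primeQ => _ QR _ _; exact: QR.
have nx := nz_ideal_principal Rx x0.
have [n [P [e [qP comax tilde]]]] := fact _ nx.
have nP i := qprime_nz_ideal (qP i).
have nPe : nz_ideal (\big[@mulm D/R]_(i < n) expm (P i) (e i)).
  by apply: nz_ideal_big => i; exact: nz_ideal_expm.
have [[sx _] _] := nx; have [[sPe _] _] := nPe.
have locE := tilde_eq_loc Hstar sx sPe tilde maxQ.
have Pex := eq_loc_gen primeQ locE (loc_gen_principal primeQ x).
have [p [pP Rp xp]] := factorization_loc_gen primeQ nP x0 Pex.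
have Rpe i : R (p i ^+ e i) by exact: DsetX.
have unit_or i : (R `\` Q) (p i ^+ e i) \/ (0 < e i)%N /\ P i `<=` Q.
  have [Qpe|nQpe] := pselect (Q (p i ^+ e i)); last by left.
  right; have [e0|e0] := posnP (e i).
    by move: Qpe; rewrite e0 => Q1; have [] := units1 primeQ.
  split=> //; have [Pp gp] := pP i e0.
  apply: (loc_gen_sub primeQ _ _ gp); first by case: (nP i).
  by apply: contrapT => nQp; have [_] := unitsX primeQ (e i) (conj (Rp i) nQp).
have [i [ei Pi]] : exists i, (0 < e i)%N /\ P i `<=` Q.
  apply: contrapT => /forallNP nQ.
  have [_] : (R `\` Q) (\prod_(i < n) p i ^+ e i); last first.
    apply; apply: associated_prime xp Qx => //.
    by apply: big_ind => // [|? ?]; [exact: Dset1 | exact: DsetM].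
  apply: big_ind => [||i _]; [exact: units1 | exact: unitsM |].
  by case: (unit_or i) => // /nQ.
have [Pp gp] := pP i ei; exists (P i), (p i), (e i); split=> //; first by case: (qP i).
split=> //; first by apply: (loc_gen_neq0 primeQ _ gp); case: (nP i) => -[].
apply: (associated_trans primeQ xp); rewrite (bigD1 i) //=.
rewrite -[X in associated _ _ X]mulr1.
apply: (associatedM primeQ); first exact: associated_refl.
apply: associated_unit => //.
apply: big_ind => [||j ji]; [exact: units1 | exact: unitsM |].
have [//|[_ Pj]] := unit_or j.
have := qmax_not_sub maxQ (comaximal_one (comax j i ji)).
by case; apply: addm_sub => //; case: primeQ.
Qed.

(* Applying the previous lemma to p a shows that the primes attached to       *)
(* different elements of Q agree.                                             *)
Lemma factorizations_uniformizer Q : has_factorizations star ->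
  quasi_maximal sf Q -> exists p, uniformizer Q p.
Proof.
move=> fact maxQ; have primeQ := qmax_prime Hstar maxQ.
have [[_ [x Qx x0]] QR] := qmax_nz_ideal maxQ.
have [P [p [e [primeP PQ Pp [_ Pdvd] [p0 _ _]]]]] := loc_prime_power fact maxQ Qx x0.
have Qp := PQ _ Pp; have Rp := QR _ Qp.
exists p; split=> // a Ra a0.
have [Qa|nQa] := pselect (Q a); last first.
  by exists 0%N; rewrite expr0; apply: associated_unit.
have Qpa : Q (p * a) by exact: prime_mul.
have [T [t [k [primeT TQ Tt [_ Tdvd] [t0 k0 pat]]]]] :=
  loc_prime_power fact maxQ Qpa (mulf_neq0 p0 a0).
case: k k0 pat => // k _ pat.
have Rt : R t by apply: QR; exact: TQ.
have Pt : P t.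
  apply: (prime_root primeP (n := k.+1)) => //.
  have [u [v [[Ru _] [Rv nQv] e']]] := pat.
  apply: (@prime_cancel _ _ primeP v) => //; [exact: DsetX | by move/PQ |].
  rewrite -e' mulrCA; apply: (prime_mul primeP) => //; exact: DsetM.
have pt := Pdvd t Pt.
(* If p is not in T, then st = pc puts c in T, so c is a multiple of t in D_Q; cancelling t makes p
   a unit there, contrary to p in Q. *)
have Tp : T p.
  have [s [Rs nQs] [c Rc e']] := pt.
  apply: contrapT => nTp; have Tc : T c.
    apply: (@prime_cancel _ _ primeT p) => //.
    by rewrite e' mulrC; exact: prime_mul.
  have [s' [Rs' nQs'] [c' Rc' e'']] := Tdvd c Tc.
  have [_ []] := unitsM primeQ (conj Rs nQs) (conj Rs' nQs').
  have -> : s * s' = p * c'.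
    apply: (mulfI t0); transitivity (s' * (s * t)); first by ring.
    by rewrite -e'; transitivity (p * (s' * c)); [ring | rewrite -e''; ring].
  exact: prime_mul.
have tp := associated_dvd primeQ (Tdvd p Tp) pt t0.
exists k; apply: (associated_cancel p0); rewrite -exprS.
apply: (associated_trans primeQ pat); exact: associatedX.
Qed.

End FactorizationsToValuations.

(** * Discrete valuation rings with finite character *)

Section LocalCharacterization.
Variable D : idomainType.
Variable star : set {fraction D} -> set {fraction D}.
Hypothesis Hstar : semistar star.
Local Notation K := {fraction D}.
Local Notation R := (Dset D).
Local Notation sf := (star_f star).
Implicit Types (E F G A B I J L P Q : set K) (x y z s t : K).

Definition locally_dvr := forall Q, quasi_maximal sf Q -> exists p, uniformizer Q p.

Definition finite_character := forall I, nz_ideal I ->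
  finite_set [set Q | quasi_maximal sf Q /\ I `<=` Q].

Lemma star_f_eq_Dset A : nz_ideal A -> sf A 1 -> sf A = sf R.
Proof.
move=> [FA AR] A1; apply/seteqP; split; first exact: star_sub_f.
apply: subset_trans (star_f_idem Hstar FA); apply: star_sub_f => x Rx.
by have [[_ _ sM] _] := star_f_Fbar Hstar FA; rewrite -[x]mulr1; exact: sM.
Qed.

(** The ideal of all d with dz in I lies in no Q, so 1 is in its star_f-closure; multiplying by z
    puts z in I^star_f. *)
Lemma star_f_loc I z : nz_ideal I -> R z ->
  (forall Q, quasi_maximal sf Q -> loc Q I z) -> sf I z.
Proof.
move=> [FI IR] Rz locz; have [[I0 ID IM] nI] := FI.
have [->|z0] := eqVneq z 0; first exact: sub_star_f.
pose A : set K := [set d | R d /\ I (d * z)].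
have nA : nz_ideal A.
  split; last by move=> d [].
  split; last first.
    by apply: nonzeroS nI => x Ix; split; [exact: IR | rewrite mulrC; exact: IM].
  split=> [|x y [Rx Ix] [Ry Iy]|a x Ra [Rx Ix]].
  - by split; [exact: Dset0 | rewrite mul0r].
  - by split; [exact: DsetD | rewrite mulrDl; exact: ID].
  - by split; [exact: DsetM | rewrite -mulrA; exact: IM].
have A1 : sf A 1.
  apply: contrapT => /(qmax_exists Hstar nA)[Q maxQ AQ].
  by have [s [Rs nQs] Isz] := locz Q maxQ; apply: nQs; apply: AQ.
rewrite -[z]mulr1; apply: star_sub_f (star_f_mul Hstar A1 z0).
by move=> _ [d [_ Idz] <-]; rewrite mulrC.
Qed.

Lemma qmax_comaximal P Q : quasi_maximal sf P -> quasi_maximal sf Q -> P <> Q ->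
  comaximal sf P Q.
Proof.
move=> maxP maxQ PQ.
have [[sP nP] PR] := qmax_nz_ideal maxP; have [[sQ nQ] QR] := qmax_nz_ideal maxQ.
have nPQ : nz_ideal (addm P Q).
  split; first exact: Fbar_addm.
  by apply: addm_sub => //; exact: submodule_Dset.
apply: star_f_eq_Dset => //; apply: contrapT => nPQ1; apply: PQ.
have QP : Q `<=` P.
  apply: subset_trans (qmax_closure Hstar maxP nPQ _ nPQ1); first exact: addmSr.
  exact: addmSl.
by case: maxQ => _ _; apply => //; case: maxP.
Qed.

Section LocallyDvr.
Hypothesis dvr : locally_dvr.

Lemma qprime_qmax P : quasi_prime sf P -> quasi_maximal sf P.
Proof.
move=> qP; have nP := qprime_nz_ideal qP.
have [Q maxQ PQ] := qmax_exists Hstar nP (qprime_star_f1 qP).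
have [p unifp] := dvr maxQ; have primeQ := qmax_prime Hstar maxQ.
suff -> : P = Q by [].
by apply: (uniformizer_prime_eq primeQ unifp) => //; [case: qP | case: nP => -[]].
Qed.

(** If JD_Q = xD_Q with x in J, a common denominator s outside Q gives sJ inside xD, so s = x(s/x)
    lies in JJ^-1. Hence no Q contains JJ^-1. *)
Lemma locally_dvr_PstarMD : PstarMD star.
Proof.
move=> J nJ gJ; have [[sJ _] JR] := nJ.
have nA := nz_ideal_mul_inv nJ (@subset_refl _ J) JR.
apply: star_f_eq_Dset => //.
apply: contrapT => /(qmax_exists Hstar nA)[Q maxQ AQ].
have primeQ := qmax_prime Hstar maxQ; have [p unifp] := dvr maxQ.
have [x [k [Jx [_ Jdvd] _ _]]] := uniformizer_ideal primeQ unifp nJ.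
have sx : submodule (dilate x R) by apply: submodule_dilate; exact: submodule_Dset.
have [s [Rs nQs] sJx] := common_denominator primeQ sx gJ Jdvd.
have x0 : x != 0.
  apply: (loc_gen_neq0 primeQ (E := J)); first by case: nJ => -[].
  by split=> //; exact: sub_loc.
apply: nQs; apply: AQ; have -> : s = x * (x^-1 * s) by rewrite mulrA mulfV ?mul1r.
apply: mulm_mul => // _ [z Jz <-].
by have [c Rc e] := sJx z Jz; rewrite -mulrA -e mulrA mulVf ?mul1r.
Qed.

(** At each Q the union of the chain is generated by one element, which already lies in some term.
    Only the finitely many Q containing I_0 matter, so one index serves all of them, and
    [star_f_loc] glues. *)
Lemma locally_dvr_noetherian : finite_character -> star_noetherian star.
Proof.
move=> fin I qI Imono.
have nI n : nz_ideal (I n) by case: (qI n).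
have Ile m n : (m <= n)%N -> I m `<=` I n.
  elim: n => [|n IHn]; first by rewrite leqn0 => /eqP->.
  by rewrite leq_eqVlt ltnS => /orP[/eqP->//|/IHn H]; exact: subset_trans (Imono n).
pose V := \bigcup_n I n.
have IV n : I n `<=` V by move=> x Ix; exists n.
have nV : nz_ideal V.
  split; last by move=> x [n _ Ix]; case: (nI n) => _; exact.
  split; last by apply: nonzeroS (IV 0%N) _; case: (nI 0%N) => -[].
  split.
  - by exists 0%N => //; case: (nI 0%N) => -[[]].
  - move=> x y [n _ Ix] [m _ Iy]; exists (maxn n m) => //.
    case: (nI (maxn n m)) => -[[_ ID _] _] _.
    by apply: ID; [apply: Ile Ix; exact: leq_maxl | apply: Ile Iy; exact: leq_maxr].
  - by move=> a x Ra [n _ Ix]; exists n => //; case: (nI n) => -[[_ _ IM] _] _; exact: IM.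
have exN Q : exists N, quasi_maximal sf Q -> V `<=` loc Q (I N).
  have [maxQ|] := pselect (quasi_maximal sf Q); last by exists 0%N.
  have primeQ := qmax_prime Hstar maxQ; have [p unifp] := dvr maxQ.
  have [x [k [[N _ Ix] [_ Vdvd] _ _]]] := uniformizer_ideal primeQ unifp nV.
  exists N => _; apply: subset_trans Vdvd _; apply: locS.
  by apply: dilate_sub => //; case: (nI N) => -[].
have [N NP] := choice exN.
have /finite_seqP[r rP] := fin _ (nI 0%N).
exists (\max_(Q <- r) N Q)%N => n; set M := (\max_(Q <- r) N Q)%N => Mn.
apply/seteqP; split; last exact: Ile.
move=> z Iz; have [[FM MR] MQ] := qI M; rewrite MQ.
have Rz : R z by case: (nI n) => _; exact.
split=> //; apply: (star_f_le Hstar) => //; apply: star_f_loc => // Q maxQ.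
have [I0Q|/existsNP[s /not_implyP[I0s nQs]]] := pselect (I 0%N `<=` Q).
  have Qr : Q \in r by have : [set` r] Q by rewrite -rP.
  have NM : (N Q <= M)%N by rewrite /M; exact: leq_bigmax_seq.
  by apply: (locS (Ile _ _ NM)); apply: NP => //; exact: IV Iz.
exists s; first by split=> //; case: (nI 0%N) => _; exact.
by rewrite mulrC; case: FM => -[_ _ IM] _; apply: IM => //; exact: Ile I0s.
Qed.

Section Products.
Variables (n : nat) (P : 'I_n -> set K) (e : 'I_n -> nat) (Q : set K) (p : K).
Hypotheses (maxP : forall i, quasi_maximal sf (P i)) (injP : injective P).
Hypotheses (maxQ : quasi_maximal sf Q) (unifp : uniformizer Q p).
Local Notation prod := (\big[@mulm D/R]_(i < n) expm (P i) (e i)).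

(** Distinct quasi-maximal ideals are incomparable, so a factor other than Q becomes trivial at
    Q. *)
Lemma prod_loc_gen_base :
  loc_gen Q prod (\prod_(i < n) (if `[< P i = Q >] then p else 1) ^+ e i).
Proof.
have primeQ := qmax_prime Hstar maxQ.
apply: loc_gen_big => // i; apply: loc_gen_exp => //.
case: asboolP => [->|PQ]; first exact: uniformizer_loc_gen.
apply: loc_gen_one => // [|PsubQ]; first by case: (qmax_nz_ideal (maxP i)).
by apply: PQ; case: (maxP i) => _ _ /(_ Q)<- //; case: maxQ.
Qed.

Lemma prod_loc_gen i : P i = Q -> loc_gen Q prod (p ^+ e i).
Proof.
move=> PQ; have := prod_loc_gen_base; rewrite (bigD1 i) //= asboolT // big1 ?mulr1 //.
move=> j ji; rewrite asboolF ?expr1n // => PjQ.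
by move/eqP: ji; apply; apply: injP; rewrite PQ.
Qed.

Lemma prod_loc_gen1 : (forall i, P i <> Q) -> loc_gen Q prod (p ^+ 0).
Proof.
move=> PQ; have := prod_loc_gen_base; rewrite big1 // => i _.
by rewrite asboolF ?expr1n.
Qed.

End Products.

(** The factors are the quasi-maximal ideals containing I, listed without repetition, with the
    valuations of I as exponents. These are positive because I lies in each factor. *)
Lemma reduced_factorization_exists I : finite_character -> nz_ideal I ->
  exists (n : nat) (P : 'I_n -> set K) (e : 'I_n -> nat),
    reduced_factorization star I P e.
Proof.
move=> fin nI; have [[sI _] IR] := nI.
have /finite_seqP[r rP] := fin _ nI.
have rQ Q : Q \in undup r <-> quasi_maximal sf Q /\ I `<=` Q.
  rewrite mem_undup; suff -> : (quasi_maximal sf Q /\ I `<=` Q) = [set` r] Q by [].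
  by rewrite -rP.
pose n := size (undup r); pose P (i : 'I_n) := nth set0 (undup r) i.
have Pr i : quasi_maximal sf (P i) /\ I `<=` P i by apply/rQ/mem_nth.
have maxP i := (Pr i).1.
have injP : injective P.
  by move=> i j /eqP; rewrite nth_uniq ?undup_uniq // => /eqP/val_inj.
have exk Q : exists pk : K * nat, quasi_maximal sf Q ->
    uniformizer Q pk.1 /\ loc_gen Q I (pk.1 ^+ pk.2).
  have [maxQ|] := pselect (quasi_maximal sf Q); last by exists (0, 0%N).
  have primeQ := qmax_prime Hstar maxQ; have [p unifp] := dvr maxQ.
  have [_ [k [_ _ _ Ik]]] := uniformizer_ideal primeQ unifp nI.
  by exists (p, k).
have [pk pkP] := choice exk; pose e i := (pk (P i)).2.
have nPe : nz_ideal (\big[@mulm D/R]_(i < n) expm (P i) (e i)).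
  by apply: nz_ideal_big => i; apply: nz_ideal_expm; exact: qmax_nz_ideal (maxP i).
have [[sPe _] _] := nPe.
exists n, P, e; split; first split.
- move=> i; split; first exact: (qmax_prime Hstar (maxP i)).
  by case: (maxP i).
- by move=> i j /eqP ij; apply: qmax_comaximal => // /injP.
- apply: (eq_tilde Hstar) => // Q maxQ; have primeQ := qmax_prime Hstar maxQ.
  have [unifp Ik] := pkP Q maxQ.
  suff gPe : loc_gen Q (\big[@mulm D/R]_(i < n) expm (P i) (e i)) ((pk Q).1 ^+ (pk Q).2).
    by rewrite (loc_gen_loc primeQ sI Ik) (loc_gen_loc primeQ sPe gPe).
  have [IQ|nIQ] := pselect (I `<=` Q).
    have Qr : Q \in undup r by apply/rQ.
    have Qn : (index Q (undup r) < n)%N by rewrite index_mem.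
    have PQ : P (Ordinal Qn) = Q by rewrite /P nth_index.
    by have := prod_loc_gen e maxP injP maxQ unifp PQ; rewrite /e PQ.
  have I1 := loc_gen_one primeQ IR nIQ; rewrite -(expr0 (pk Q).1) in I1.
  rewrite (uniformizer_loc_gen_inj primeQ unifp Ik I1).
  by apply: prod_loc_gen1 => // i PQ; apply: nIQ; rewrite -PQ; case: (Pr i).
- move=> i tilde; have primeP := qmax_prime Hstar (maxP i).
  have [[sP _] _] := qmax_nz_ideal (maxP i).
  have PR := tilde_eq_loc Hstar sP (submodule_Dset D) tilde (maxP i).
  have [_] := units1 primeP; apply; apply: (loc_prime primeP); first exact: Dset1.
  by rewrite PR; apply: sub_loc => //; exact: Dset1.
- move=> i; rewrite lt0n; apply/eqP => ei.
  have primeP := qmax_prime Hstar (maxP i); have [_ Ik] := pkP _ (maxP i).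
  have [_] := units1 primeP; apply; apply: (loc_prime primeP); first exact: Dset1.
  by move: Ik; rewrite -/(e i) ei expr0 => -[I1 _]; apply: locS I1; case: (Pr i).
Qed.

Lemma factorization_qmax I n (P : 'I_n -> set K) (e : 'I_n -> nat) :
  factorization star I P e -> (forall i, quasi_maximal sf (P i)) /\ injective P.
Proof.
move=> [qP comax _]; have maxP i := qprime_qmax (qP i); split=> // i j Pij.
apply: contrapT => /eqP/comax/(comaximal_one Hstar); rewrite -Pij => P1.
have [[sP _] _] := qmax_nz_ideal (maxP i).
by apply: (qmax_not_sub (maxP i) P1); exact: addm_sub.
Qed.

(** At P_i both products have valuation e_i > 0. If P_i were missing from the second family, its
    product would have valuation 0 there; otherwise the exponents must agree. *)
Lemma reduced_factorization_sub I n m (P : 'I_n -> set K) (e : 'I_n -> nat)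
    (Q : 'I_m -> set K) (f : 'I_m -> nat) : nz_ideal I ->
  reduced_factorization star I P e -> reduced_factorization star I Q f ->
  forall i, exists j, Q j = P i /\ f j = e i.
Proof.
move=> [[sI _] _] [fP _ e0] [fQ _ _] i.
have [maxP injP] := factorization_qmax fP.
have [maxQ injQ] := factorization_qmax fQ.
have [p unifp] := dvr (maxP i); have primeP := qmax_prime Hstar (maxP i).
have sub k (S : 'I_k -> set K) g : (forall i, quasi_maximal sf (S i)) ->
    submodule (\big[@mulm D/R]_(i < k) expm (S i) (g i)).
  move=> maxS; have [] // : nz_ideal (\big[@mulm D/R]_(i < k) expm (S i) (g i)).
    by apply: nz_ideal_big => l; apply: nz_ideal_expm; exact: qmax_nz_ideal (maxS l).
  by case.
have locE : loc (P i) (\big[@mulm D/R]_(i < n) expm (P i) (e i)) =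
            loc (P i) (\big[@mulm D/R]_(j < m) expm (Q j) (f j)).
  apply: (tilde_eq_loc Hstar) => //; [exact: sub | exact: sub |].
  by case: fP => _ _ <-; case: fQ.
have gP := eq_loc_gen primeP locE (prod_loc_gen e maxP injP (maxP i) unifp erefl).
have [[j Qj]|nQ] := pselect (exists j, Q j = P i).
  exists j; split=> //; apply: (uniformizer_loc_gen_inj primeP unifp _ gP).
  exact: prod_loc_gen.
have := prod_loc_gen1 f maxQ (maxP i) unifp (fun j Qj => nQ (ex_intro _ j Qj)).
move/(uniformizer_loc_gen_inj primeP unifp gP) => ei.
by have := e0 i; rewrite ei.
Qed.

Lemma reduced_factorization_unique I n m (P : 'I_n -> set K) (e : 'I_n -> nat)
    (Q : 'I_m -> set K) (f : 'I_m -> nat) : nz_ideal I ->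
  reduced_factorization star I P e -> reduced_factorization star I Q f ->
  exists s : 'I_n -> 'I_m,
    bijective s /\ forall i, Q (s i) = P i /\ f (s i) = e i.
Proof.
move=> nI fP fQ.
have [s sP] := choice (reduced_factorization_sub nI fP fQ).
have [t tP] := choice (reduced_factorization_sub nI fQ fP).
have [_ injP] := factorization_qmax (let: And3 h _ _ := fP in h).
have [_ injQ] := factorization_qmax (let: And3 h _ _ := fQ in h).
exists s; split=> //; exists t => [i|j].
  by apply: injP; rewrite (tP _).1 (sP _).1.
by apply: injQ; rewrite (sP _).1 (tP _).1.
Qed.

End LocallyDvr.

Lemma factorizations_locally_dvr : has_factorizations star -> locally_dvr.
Proof. by move=> fact Q; exact: factorizations_uniformizer. Qed.

(** If Q contains I and differs from every P_i, the product is trivial at Q, so 1 lies in ID_Q,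
    inside QD_Q, which is absurd. *)
Lemma factorizations_finite_character :
  has_factorizations star -> finite_character.
Proof.
move=> fact I nI; have dvr := factorizations_locally_dvr fact.
have [n [P [e fP]]] := fact I nI; have [maxP _] := factorization_qmax dvr fP.
apply: (@sub_finite_set _ _ [set P i | i in [set: 'I_n]]); last first.
  by apply: finite_image; exact: finite_finset.
move=> Q [maxQ IQ]; apply: contrapT => nPQ.
have primeQ := qmax_prime Hstar maxQ; have [p unifp] := dvr Q maxQ.
have nPe : nz_ideal (\big[@mulm D/R]_(i < n) expm (P i) (e i)).
  by apply: nz_ideal_big => i; apply: nz_ideal_expm; exact: qmax_nz_ideal (maxP i).
have [[sPe _] _] := nPe; have [[sI _] _] := nI; case: fP => _ _ tilde.
have locE := tilde_eq_loc Hstar sI sPe tilde maxQ.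
have [|P1 _] := prod_loc_gen1 e maxP maxQ unifp.
  by move=> i Pi; apply: nPQ; exists i.
have [_] := units1 primeQ; apply; apply: (loc_prime primeQ); first exact: Dset1.
by apply: (locS IQ); rewrite locE -(expr0 p).
Qed.

(** * Star-Dedekind domains are locally discrete valuation rings with finite character *)

Section Dedekind.
Hypotheses (noeth : star_noetherian star) (PMD : PstarMD star).

Lemma quasi_closure_star E : Fbar D E -> E `<=` R ->
  quasi_ideal star (star E `&` R).
Proof.
move=> FE ER; have FsE := star_Fbar Hstar FE.
have E' : E `<=` star E `&` R by move=> x Ex; split; [exact: sub_star | exact: ER].
have nz : nz_ideal (star E `&` R).
  split; last by move=> x [].
  split; last by apply: nonzeroS E' _; case: FE.
  case: FsE => -[I0 ID IM] _; have [R0 RD RM] := submodule_Dset D.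
  by split=> [//|x y [? ?] [? ?]|a x Ra [? ?]]; split; auto.
split=> //; apply/seteqP; split=> x [sx Rx]; split=> //.
  by apply: (sub_star Hstar) => //; case: nz.
by apply: (star_le Hstar) sx => [|//|y []//]; case: nz.
Qed.

(** Otherwise, starting from xD, one keeps adjoining an element of I outside the star closure
    reached so far, and the traces of these closures on D never stabilize. *)
Lemma noetherian_approx I : nz_ideal I ->
  exists J, [/\ fgFbar D J, J `<=` I & I `<=` star J].
Proof.
move=> [[sI [x Ix x0]] IR]; apply: contrapT => /forallNP nJ.
have exz J : exists z, fgFbar D J -> J `<=` I -> I z /\ ~ star J z.
  have [[fJ JI]|H] := pselect (fgFbar D J /\ J `<=` I); last first.
    by exists 0 => ? ?; case: H.
  apply: contrapT => /forallNP H; apply: (nJ J); split=> // z Iz.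
  by apply: contrapT => nz; apply: (H z).
have [f fP] := choice exz.
pose J n := iter n (fun J => addm J (dilate (f J) R)) (dilate x R).
have J_ n : fgFbar D (J n) /\ J n `<=` I.
  elim: n => [|n [fJ JI]].
    by split; [exact: fgFbar_principal | exact: dilate_sub].
  have [If nf] := fP _ fJ JI; have [FJ _] := fJ.
  have f0 : f (J n) != 0.
    by apply/eqP => f0; apply: nf; rewrite f0; case: (star_Fbar Hstar FJ) => -[].
  split; first by apply: fgFbar_addm => //; exact: fgFbar_principal.
  by apply: addm_sub => //; exact: dilate_sub.
have FJ n : Fbar D (J n) by case: (J_ n) => -[].
have JR n : J n `<=` R by apply: subset_trans IR; case: (J_ n).
have JS n : J n `<=` J n.+1.
  by apply: addmSl; apply: submodule_dilate; exact: submodule_Dset.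
have [||N /(_ N.+1 (leqnSn N)) CN] := noeth (I := fun n => star (J n) `&` R).
- by move=> n; exact: quasi_closure_star.
- by move=> n z [Jz Rz]; split=> //; apply: star_mono Jz.
have [If nf] := fP _ (J_ N).1 (J_ N).2; apply: nf.
have [//] : (star (J N) `&` R) (f (J N)).
rewrite -CN; split; last exact: IR.
apply: (sub_star Hstar) => //; apply: addmSr; last exact: dilate1.
by case: (FJ N).
Qed.

(* Let L = J + zD, which is star_f-invertible. If J L^-1 is not contained in  *)
(* Q, then z lies in J D_Q. Otherwise Q contains J L^-1, whose star closure   *)
(* contains L L^-1 and hence 1, which contradicts that Q is proper.           *)
Lemma star_sub_loc J z Q : nz_ideal J -> fin_gen J -> quasi_maximal sf Q ->
  R z -> star J z -> loc Q J z.
Proof.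
move=> nJ gJ maxQ Rz Jz; have primeQ := qmax_prime Hstar maxQ.
have [FJ JR] := nJ; have [sJ nzJ] := FJ; have [_ _ JM] := sJ.
have [->|z0] := eqVneq z 0; first by case: (submodule_loc primeQ sJ).
have sz : submodule (dilate z R) by apply: submodule_dilate; exact: submodule_Dset.
pose L := addm J (dilate z R).
have JL : J `<=` L by exact: addmSl.
have Lz : L z by apply: addmSr => //; exact: dilate1.
have nL : nz_ideal L.
  split; first exact: Fbar_addm.
  apply: addm_sub => //; first exact: submodule_Dset.
  by apply: dilate_sub => //; exact: submodule_Dset.
have [_ LR] := nL.
have gL : fin_gen L by apply: fin_gen_addm => //; exact: fin_gen_principal.
have nA := nz_ideal_mul_inv nJ JL LR; have [FA _] := nA.
have [AQ|nAQ] := pselect (mulm J (inv_ideal L) `<=` Q); last first.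
  have [j [y [Jj Ly nQ]]] : exists j y, [/\ J j, inv_ideal L y & ~ Q (j * y)].
    apply: contrapT => H; apply: nAQ; apply: mulm_sub; first by case: primeQ.
    by move=> j y Jj Ly; apply: contrapT => nQ; apply: H; exists j, y.
  exists (j * y); first by split=> //; apply: inv_idealP Ly; exact: JL.
  have -> : j * y * z = (z * y) * j by ring.
  by apply: JM => //; exact: inv_idealP Lz Ly.
exfalso; set A := mulm J (inv_ideal L) in nA FA AQ.
have nB := nz_ideal_mul_inv nL (@subset_refl _ L) LR; have [FB _] := nB.
(* The new products are multiples of zy with y in L^-1; such zy lies in (yJ)^star, and yJ is inside
   A. *)
have BA : mulm L (inv_ideal L) `<=` star A.
  have [[A0 AD AM] _] := star_Fbar Hstar FA.
  apply: mulm_sub; first by split.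
  move=> _ y [j Jj [_ [r Rr <-] <-]] Ly; rewrite mulrDl; apply: AD.
    by apply: (sub_star Hstar) => //; exact: mulm_mul.
  rewrite mulrAC mulrC; apply: AM => //; rewrite mulrC.
  have [->|y0] := eqVneq y 0; first by rewrite mul0r.
  apply: (star_mono Hstar) (star_mul Hstar FJ Jz y0) => //.
    exact: Fbar_dilate.
  by move=> _ [c Jc <-]; rewrite mulrC; exact: mulm_mul.
have A1 : star A 1.
  apply: (star_le Hstar) BA _ _ => //; apply: (star_f_le Hstar) => //.
  rewrite (PMD nL gL); apply: (sub_star_f Hstar); [exact: Fbar_Dset | exact: Dset1].
(* Replacing A by a finitely generated F turns 1 in A^star into 1 in Q^star_f. *)
have [F [fF FsA AF]] := noetherian_approx nA.
apply: (qmax_star_f1 maxQ); exists F; first by split=> //; exact: subset_trans AQ.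
by apply: (star_le Hstar) AF _ A1 => //; case: fF.
Qed.

Lemma star_approx I : nz_ideal I -> exists J, [/\ nz_ideal J, fin_gen J, J `<=` I,
  I `<=` star J & forall Q z, quasi_maximal sf Q -> R z -> star I z -> loc Q J z].
Proof.
move=> nI; have [FI IR] := nI; have [J [[FJ gJ] JI IJ]] := noetherian_approx nI.
have nJ : nz_ideal J by split=> //; exact: subset_trans IR.
exists J; split=> // Q z maxQ Rz Iz; apply: star_sub_loc => //.
exact: (star_le Hstar) IJ _ Iz.
Qed.

(** For the J of [star_approx], invertibility gives x in J and y in J^-1 with xy outside Q; then
    (xy)j = x(jy) makes x a generator of JD_Q, which contains I. *)
Lemma dedekind_loc_principal I Q : nz_ideal I -> quasi_maximal sf Q ->
  exists2 x, I x & loc_gen Q I x.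
Proof.
move=> nI maxQ; have primeQ := qmax_prime Hstar maxQ; have [FI IR] := nI.
have [J [nJ gJ JI IJ locJ]] := star_approx nI; have [[sJ _] JR] := nJ.
have nA := nz_ideal_mul_inv nJ (@subset_refl _ J) JR.
have [x [y [Jx Jy nQ]]] : exists x y, [/\ J x, inv_ideal J y & ~ Q (x * y)].
  apply: contrapT => H; apply: (qmax_not_sub maxQ (I := mulm J (inv_ideal J))).
    by rewrite (PMD nJ gJ); apply: (sub_star_f Hstar (Fbar_Dset D)); exact: Dset1.
  apply: mulm_sub; first by case: primeQ.
  by move=> x y Jx Jy; apply: contrapT => nQ; apply: H; exists x, y.
exists x; first exact: JI.
split=> [|z Iz]; first by apply: sub_loc => //; exact: JI.
have : loc Q J z by apply: locJ => //; [exact: IR | exact: sub_star].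
apply: loc_sub => // j Jj; exists (x * y); first by split=> //; exact: inv_idealP Jy.
by exists (j * y); [exact: inv_idealP Jy | ring].
Qed.

(** With p generating QD_Q, a nonzero x is a unit times the highest power of p dividing it; the
    point is that this power exists. *)
Lemma dedekind_locally_dvr : locally_dvr.
Proof.
move=> Q maxQ; have primeQ := qmax_prime Hstar maxQ.
have nQ := qmax_nz_ideal maxQ; have [[sQ nzQ] QR] := nQ.
have [p Qp gp] := dedekind_loc_principal nQ maxQ.
have p0 := loc_gen_neq0 primeQ nzQ gp; have Rp := QR p Qp.
have sub x : submodule (loc Q (dilate x R)).
  by apply: submodule_loc => //; apply: submodule_dilate; exact: submodule_Dset.
exists p; split=> // x Rx x0.
have exn : exists n, `[< ~ loc Q (dilate (p ^+ n) R) x >].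
  (* Otherwise the ideal of all d with x | p^n d for some n is not principal  *)
  (* at Q.                                                                    *)
  apply: contrapT => /forallNP dvd.
  have {}dvd n : loc Q (dilate (p ^+ n) R) x.
    by apply: contrapT => ndvd; apply: (dvd n); apply/asboolP.
  pose I : set K := [set d | R d /\ exists n, loc Q (dilate x R) (p ^+ n * d)].
  have nI : nz_ideal I.
    have [x_0 xD xM] := sub x.
    split; last by move=> d [].
    split; last first.
      exists x => //; split=> //; exists 0%N; rewrite expr0 mul1r.
      by apply: sub_loc => //; exact: dilate1.
    split.
    - by split; [exact: Dset0 | exists 0%N; rewrite mulr0].
    - move=> a b [Ra [n an]] [Rb [m bm]]; split; first exact: DsetD.
      exists (n + m)%N; rewrite mulrDr exprD; apply: xD.
        by rewrite -mulrA mulrCA; apply: xM => //; exact: DsetX.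
      by rewrite -mulrA; apply: xM => //; exact: DsetX.
    - move=> a b Ra [Rb [n bn]]; split; first exact: DsetM.
      by exists n; rewrite mulrCA; exact: xM.
  (* Let y generate this ideal at Q, with x dividing p^n y. Up to units x = p^(n+1) b with b in the
     ideal, so x is a multiple of p p^n y, hence of px, which is absurd as p is in Q. *)
  have [y [Ry [n [s [Rs nQs] [a Ra xa]]]] [_ Iy]] := dedekind_loc_principal nI maxQ.
  have [t [Rt nQt] [b Rb xb]] := dvd n.+1.
  have [r [Rr nQr] [c Rc yc]] : loc Q (dilate y R) b.
    apply: Iy; split=> //; exists n.+1; rewrite xb; apply: sub_loc => //.
    by exists t => //; rewrite mulrC.
  have [_] := unitsM primeQ (unitsM primeQ (conj Rr nQr) (conj Rt nQt)) (conj Rs nQs).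
  apply; have -> : r * t * s = p * (a * c).
    apply: (mulIf x0); transitivity (r * s * (t * x)); first by ring.
    rewrite -xb exprS; transitivity (p * p ^+ n * s * (r * b)); first by ring.
    rewrite -yc; transitivity (p * (s * (p ^+ n * y)) * c); first by ring.
    by rewrite -xa; ring.
  by apply: prime_mul => //; exact: DsetM.
case: (ex_minnP exn) => -[|k] /asboolP ndvd kmin.
  by case: ndvd; apply: sub_loc => //; exists x; rewrite ?expr0 ?mul1r.
have [s Us [a Ra pa]] : loc Q (dilate (p ^+ k) R) x.
  by apply: contrapT => ndvdk; have := kmin k; rewrite ltnn => /(_ (asboolT ndvdk)).
exists k, s, a; split=> //; last by rewrite -pa mulrC.
split=> // Qa; apply: ndvd; have [t Ut [b Rb pb]] := gp.2 a Qa.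
exists (t * s); first exact: unitsM.
by exists b => //; rewrite exprSr -mulrA pb mulrCA pa mulrA.
Qed.

(** Given infinitely many Q_k containing x, the ideals [C n] are quasi-star-ideals because, by
    [star_approx], star adds nothing locally. If the chain stops at N, an element of [C N.+1] that
    is not in xD_{Q_N} gives a contradiction. *)
Lemma dedekind_finite_character : finite_character.
Proof.
move=> I [[sI [x Ix x0]] IR].
apply: contrapT => /infiniteP/ppcard_leP[Q].
have [maxQ xQ] : (forall k, quasi_maximal sf (Q k)) /\ forall k, Q k x.
  by split=> k; have [? IQ] := @funS _ _ _ _ Q k Logic.I; [|exact: IQ].
have Rx := IR x Ix.
have primeQ_ k := qmax_prime Hstar (maxQ k).
have sdvd k z : submodule (loc (Q k) (dilate z R)).
  apply: submodule_loc => //.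
  by apply: submodule_dilate; exact: submodule_Dset.
pose C n : set K := [set d | R d /\ forall k, (n <= k)%N -> loc (Q k) (dilate x R) d].
have nC n : nz_ideal (C n).
  split; last by move=> d [].
  split; last first.
    exists x => //; split=> // k _; apply: sub_loc => //; exact: dilate1.
  split=> [|a b [Ra aC] [Rb bC]|a b Ra [Rb bC]].
  - by split; [exact: Dset0 | move=> k _; case: (sdvd k x)].
  - split; first exact: DsetD.
    by move=> k nk; have [_ sD _] := sdvd k x; apply: sD; [exact: aC | exact: bC].
  - split; first exact: DsetM.
    by move=> k nk; have [_ _ sM] := sdvd k x; apply: sM => //; exact: bC.
have qC n : quasi_ideal star (C n).
  split=> //; apply/seteqP; split=> z.
    by move=> Cz; split; [apply: (sub_star Hstar) => //; case: (nC n) | case: Cz].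
  move=> [sCz Rz]; split=> // k nk.
  have [J [_ _ JC _ locJ]] := star_approx (nC n).
  have primeQ := qmax_prime Hstar (maxQ k).
  apply: (loc_sub primeQ (E := J)); last exact: locJ.
  by move=> d /JC[_]; exact.
have [|N /(_ N.+1 (leqnSn N)) CN] := noeth qC.
  by move=> n d [Rd dC]; split=> // k nk; apply: dC; exact: ltnW.
have primeQ := qmax_prime Hstar (maxQ N); have [[sQ nzQ] QR] := qmax_nz_ideal (maxQ N).
have [p unifp] := dedekind_locally_dvr (maxQ N).
have [Qp p0 _] := unifp; have Rp := QR p Qp.
have [_ Qdvd] := uniformizer_loc_gen primeQ unifp.
have [J [nJ gJ JQ QJ _]] := star_approx (qmax_nz_ideal (maxQ N)).
have sx : submodule (dilate x R) by apply: submodule_dilate; exact: submodule_Dset.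
have [[sJ _] _] := nJ.
have [s [Rs nQs] sF] : exists2 s, (R `\` Q N) s &
    forall z, addm J (dilate x R) z -> dilate p R (s * z).
  apply: (common_denominator primeQ).
  - by apply: submodule_dilate; exact: submodule_Dset.
  - by apply: fin_gen_addm => //; exact: fin_gen_principal.
  - by apply: subset_trans Qdvd; apply: addm_sub => //; exact: dilate_sub.
(* This d = sx/p has valuation one less than x at Q_N, so it is not in xD_{Q_N}. *)
have [d Rd pd] : dilate p R (s * x) by apply: sF; apply: addmSr => //; exact: dilate1.
have : C N.+1 d.
  split=> // k Nk; have primeQk := qmax_prime Hstar (maxQ k).
  (* If J lay in Q_k, then Q_N, being inside J^star with J finitely generated, would lie in the
     quasi-star_f-ideal Q_k. Otherwise some j in J outside Q_k satisfies jd = x(sj/p), with sj/p in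
     D. *)
  have [JQk|/existsNP[j /not_implyP[Jj nQj]]] := pselect (J `<=` Q k).
    have QNk : Q N `<=` Q k.
      have [_ Qq] := (let: And3 q _ _ := maxQ k in q).
      move=> z Qz; rewrite Qq; split; last exact: QR.
      exists J; [by split=> //; split=> //; case: nJ | exact: QJ].
    have eQ : Q k = Q N.
      case: (maxQ N) => _ _; apply=> //; by case: (maxQ k).
    have /eqP := 'inj_Q (mem_setT k) (mem_setT N) eQ.
    by rewrite gtn_eqF.
  have Rj : R j by apply: QR; exact: JQ.
  have [c Rc pc] : dilate p R (s * j) by apply: sF; exact: addmSl.
  exists j => //; exists c => //; apply: (mulfI p0).
  rewrite mulrCA pc; transitivity (s * x * j); first by ring.
  by rewrite -pd; ring.
rewrite CN => -[_ /(_ N (leqnn N))[t [Rt nQt] [r Rr xr]]].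
have [_] := unitsM primeQ (conj Rt nQt) (conj Rs nQs).
apply; have -> : t * s = p * r; last exact: prime_mul.
apply: (mulIf x0); transitivity (t * (s * x)); first by ring.
by rewrite -pd; transitivity (p * (t * d)); [ring | rewrite -xr; ring].
Qed.

End Dedekind.

End LocalCharacterization.

Theorem theorem4p25 (D : idomainType)
    (star : set {fraction D} -> set {fraction D}) (Hstar : semistar star) :
  (star_dedekind star <-> has_factorizations star) /\
  (has_factorizations star ->
   forall I : set {fraction D}, nz_ideal I ->
   star_tilde star I <> star_tilde star (Dset D) ->
   (exists (n : nat) (P : 'I_n -> set {fraction D}) (e : 'I_n -> nat),
      reduced_factorization star I P e) /\
   (forall (n m : nat) (P : 'I_n -> set {fraction D}) (e : 'I_n -> nat)
      (Q : 'I_m -> set {fraction D}) (f : 'I_m -> nat),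
      reduced_factorization star I P e -> reduced_factorization star I Q f ->
      exists s : 'I_n -> 'I_m,
        bijective s /\ forall i, Q (s i) = P i /\ f (s i) = e i)).
Proof.
have dedekindE : star_dedekind star <-> locally_dvr star /\ finite_character star.
  split=> [[noeth PMD]|[dvr fin]].
    by split; [exact: dedekind_locally_dvr | exact: dedekind_finite_character].
  by split; [exact: locally_dvr_noetherian | exact: locally_dvr_PstarMD].
have factE : has_factorizations star <-> locally_dvr star /\ finite_character star.
  split=> [fact|[dvr fin] I nI].
    split; first exact: factorizations_locally_dvr.
    exact: factorizations_finite_character.
  have [n [P [e [? _ _]]]] := reduced_factorization_exists Hstar dvr fin nI.
  by exists n, P, e.
split; first exact: iff_trans dedekindE (iff_sym factE).
move=> /factE[dvr fin] I nI _; split; first exact: reduced_factorization_exists.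
by move=> n m P e Q f; exact: reduced_factorization_unique.
Qed.
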